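(* Let $\{J_1,J_2,J_3\}$ be a left invariant hypercomplex structure on the simply connected Lie group $G$ and let $\Gamma$ be a uniform lattice in $G$. If there exists an invariant trivializing section of $K_{(\Gamma\backslash G,J_\alpha)}$ for some $\alpha\in\{1,2,3\}$, then $(\Gamma\backslash G,J_a)$ has trivial canonical bundle for any $a=(a_1,a_2,a_3)\in\mathbb{S}^2$, where $J_a:=a_1J_1+a_2J_2+a_3J_3$.
   Context: A hypercomplex structure on a manifold is a triple of (integrable) complex structures $\{J_1,J_2,J_3\}$ with $J_1J_2=-J_2J_1=J_3$; then each $J_a$, $a\in\mathbb{S}^2\subset\mathbb{R}^3$, is a complex structure. It is left invariant on $G$ if left translations are holomorphic with respect to each $J_\alpha$; it then induces a hypercomplex structure (same notation) on $\Gamma\backslash G$. A uniform lattice is a discrete subgroup $\Gamma$ with $\Gamma\backslash G$ compact. $K_{(M,J)}$ denotes the canonical bundle (top exterior power of the holomorphic cotangent bundle) of the complex manifold $(M,J)$; it is trivial if holomorphically trivial, and a trivializing section is a nowhere vanishing holomorphic (equivalently closed) form of top type $(m,0)$, $m=\dim_{\mathbb{C}}M$. A section on $\Gamma\backslash G$ is invariant if it is induced by a left invariant form on $G$. *)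

(* Defs.v *)
From HB Require Import structures.
From mathcomp Require Import all_boot all_order all_algebra.
From mathcomp Require Import generic_quotient complex.
From mathcomp Require Import all_classical all_reals all_analysis.

Set Implicit Arguments.
Unset Strict Implicit.
Unset Printing Implicit Defensive.

Import Order.TTheory GRing.Theory Num.Theory.
Import numFieldNormedType.Exports.
Local Open Scope classical_set_scope.
Local Open Scope quotient_scope.
Local Open Scope ring_scope.

(* Bare join, without compatibility axioms: continuity (and smoothness) of the
   group operations is part of [lie_group] below. *)
#[short(type="groupTopologicalType")]
HB.structure Definition GroupTopological := {G of Group G & Topological G}.

Section Smooth.
Context {R : realType} {V W : normedModType R}.

(* Meant for open U and finite-dimensional V, where C^k+1 means: differentiable
   with all directional derivatives of class C^k. *)
Fixpoint Ck (k : nat) (U : set V) (f : V -> W) : Prop :=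
  if k is k'.+1 then
    (forall x, U x -> differentiable f x) /\
    (forall v : V, Ck k' U (fun x => 'D_v f x))
  else forall x, U x -> {for x, continuous f}.

Definition smooth_on (U : set V) (f : V -> W) := forall k, Ck k U f.

End Smooth.

(* The chart i maps the open set [dom i] of M to R^N by [coord i], and [par i]
   is its inverse on [coord i @` dom i]; both have irrelevant values elsewhere.
   The axioms are in [smooth_manifold]. *)
Record atlas (R : realType) (N : nat) (M : topologicalType) := Atlas {
  chart : Type;
  dom : chart -> set M;
  coord : chart -> M -> 'cV[R]_N;
  par : chart -> 'cV[R]_N -> M
}.

Section Manifold.
Context {R : realType} {N : nat} {M : topologicalType}.
Variable A : atlas R N M.

Definition img (i : chart A) : set 'cV[R]_N := coord i @` dom i.

Definition smooth_manifold : Prop :=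
  [/\ hausdorff_space M /\ @second_countable M,
      forall p : M, exists i : chart A, dom i p,
      forall i : chart A, [/\ open (dom i), open (img i)
        & forall p, dom i p -> par i (coord i p) = p],
      forall i : chart A, {within dom i, continuous (coord i)} /\
        {within img i, continuous (par i)}
    & forall i j : chart A, smooth_on (coord i @` (dom i `&` dom j))
        (coord j \o par i)].

End Manifold.

Section SmoothMap.
Context {R : realType} {N : nat} {M M' : topologicalType}.
Variables (A : atlas R N M) (A' : atlas R N M').

Definition local_rep (f : M -> M') (i : chart A) (j : chart A') :
    'cV[R]_N -> 'cV[R]_N :=
  coord j \o f \o par i.

Definition smooth_map (f : M -> M') : Prop :=
  continuous f /\
  forall (i : chart A) (j : chart A'), smooth_on (coord i @` (dom i `&` f @^-1` dom j)) (local_rep f i j).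

Definition tangent_map (f : M -> M') (i : chart A) (j : chart A') (p : M)
    (v : 'cV[R]_N) : 'cV[R]_N :=
  'D_v (local_rep f i j) (coord i p).

End SmoothMap.

(* Tensor fields are families of local expressions, one per chart, as functions
   of the coordinates; only the values on [img i] matter. An endomorphism acts
   on (column) tangent vectors by left multiplication. *)
Definition endo_field (R : realType) (N : nat) (M : topologicalType)
  (A : atlas R N M) := chart A -> 'cV[R]_N -> 'M[R]_N.

Definition cform (R : realType) (N : nat) (M : topologicalType)
  (A : atlas R N M) (k : nat) :=
  chart A -> 'cV[R]_N -> ('I_k -> 'cV[R]_N) -> R[i].

Section Pullback.
Context {R : realType} {N : nat} {M M' : topologicalType}.
Variables (A : atlas R N M) (A' : atlas R N M').

(* df o J = J' o df *)
Definition intertwines (f : M -> M') (J : endo_field A) (J' : endo_field A') :=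
  forall (i : chart A) (j : chart A') p v, dom i p -> dom j (f p) ->
    tangent_map f i j p (J i (coord i p) *m v) =
    J' j (coord j (f p)) *m tangent_map f i j p v.

Definition holomorphic (f : M -> M') (J : endo_field A) (J' : endo_field A') :=
  smooth_map A A' f /\ intertwines f J J'.

(* w = f^* w' *)
Definition is_pullback (k : nat) (f : M -> M') (w' : cform A' k)
    (w : cform A k) :=
  forall (i : chart A) (j : chart A') p v, dom i p -> dom j (f p) ->
    w i (coord i p) v =
    w' j (coord j (f p)) (fun l => tangent_map f i j p (v l)).

End Pullback.

Section Tensors.
Context {R : realType} {N : nat} {M : topologicalType}.
Variable A : atlas R N M.

(* [intertwines id] and [is_pullback id] are the transformation rules between
   the local expressions in overlapping charts. *)
Definition smooth_endo_field (J : endo_field A) : Prop :=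
  intertwines id J J /\ forall i, smooth_on (img i) (J i).

Definition replace (k : nat) (v : 'I_k -> 'cV[R]_N) (l : 'I_k) (u : 'cV[R]_N) :
    'I_k -> 'cV[R]_N :=
  fun l' => if l' == l then u else v l'.

Definition multilinear_form (k : nat) (f : ('I_k -> 'cV[R]_N) -> R[i]) :=
  forall v l (a : R) u u',
    f (replace v l (a *: u + u')) =
    (a%:C)%C * f (replace v l u) + f (replace v l u').

Definition alternating_form (k : nat) (f : ('I_k -> 'cV[R]_N) -> R[i]) :=
  forall v l l', l != l' -> v l = v l' -> f v = 0.

Definition differential_form (k : nat) (w : cform A k) : Prop :=
  [/\ forall i x, img i x -> multilinear_form (w i x) /\ alternating_form (w i x),
      is_pullback id w w
    & forall i v, smooth_on (img i) (fun x => complex.Re (w i x v)) /\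
        smooth_on (img i) (fun x => complex.Im (w i x v))].

(* Directional derivative of a complex-valued function. *)
Definition cderive (f : 'cV[R]_N -> R[i]) (x v : 'cV[R]_N) : R[i] :=
  ('D_v (fun y => complex.Re (f y)) x +i* 'D_v (fun y => complex.Im (f y)) x)%C.

(* dw(v_0, .., v_k) for vector fields that are constant in the chart, so that
   no bracket terms appear. *)
Definition ext_derivative (k : nat) (w : cform A k) : cform A k.+1 :=
  fun i x v =>
    \sum_(l < k.+1) (-1) ^+ l * cderive (fun y => w i y (v \o lift l)) x (v l).

Definition closed_form (k : nat) (w : cform A k) : Prop :=
  forall i x v, img i x -> ext_derivative w i x v = 0.

Definition vf_bracket (X Y : 'cV[R]_N -> 'cV[R]_N) (x : 'cV[R]_N) : 'cV[R]_N :=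
  'D_(X x) Y x - 'D_(Y x) X x.

(* [JX, JY] - J([JX, Y] + [X, JY]) - [X, Y] on the coordinate fields X = u,
   Y = v; this suffices since the expression is tensorial. *)
Definition nijenhuis (J : endo_field A) i (u v x : 'cV[R]_N) : 'cV[R]_N :=
  let X := cst u in let Y := cst v in
  let JX := fun y => J i y *m u in let JY := fun y => J i y *m v in
  vf_bracket JX JY x - J i x *m (vf_bracket JX Y x + vf_bracket X JY x)
  - vf_bracket X Y x.

Definition complex_structure (J : endo_field A) : Prop :=
  [/\ smooth_endo_field J,
      forall i x, img i x -> J i x *m J i x = - 1%:M
    & forall i u v x, img i x -> nijenhuis J i u v x = 0].

Definition hypercomplex_structure (J : 'I_3 -> endo_field A) : Prop :=
  (forall al, complex_structure (J al)) /\
  forall i x, img i x ->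
    J 0 i x *m J 1 i x = J 2 i x /\ J 1 i x *m J 0 i x = - J 2 i x.

Definition endo_comb (a : 'rV[R]_3) (J : 'I_3 -> endo_field A) : endo_field A :=
  fun i x => \sum_(al < 3) a 0 al *: J al i x.

(* Type (k,0): the contraction with any vector u + iJu of T^{0,1} vanishes. *)
Definition type_k0 (J : endo_field A) (k : nat) (w : cform A k) : Prop :=
  forall i x v l, img i x ->
    w i x v + ('i)%C * w i x (replace v l (J i x *m v l)) = 0.

Definition nowhere_vanishing (k : nat) (w : cform A k) : Prop :=
  forall i x, img i x -> exists v, w i x v != 0.

(* The complex dimension is N./2. For forms w of top type (N./2, 0) one has
   dw = dbar w, so that holomorphic means closed. *)
Definition trivializing_section (J : endo_field A) (w : cform A N./2) : Prop :=
  [/\ differential_form w, type_k0 J w, nowhere_vanishing w & closed_form w].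

Definition trivial_canonical_bundle (J : endo_field A) : Prop :=
  exists w, trivializing_section J w.

End Tensors.

Definition simply_connected (R : realType) (M : topologicalType) : Prop :=
  [/\ exists p : M, True,
      forall p q : M, exists c : R -> M,
        [/\ {within `[0, 1], continuous c}, c 0 = p & c 1 = q]
    & forall c : R -> M, {within `[0, 1], continuous c} -> c 0 = c 1 ->
      exists H : R * R -> M,
        [/\ {within `[0, 1] `*` `[0, 1], continuous H},
            forall t, t \in `[0, 1] -> H (0, t) = c t /\ H (1, t) = c 0
          & forall s, s \in `[0, 1] -> H (s, 0) = c 0 /\ H (s, 1) = c 0]].

Section LieGroup.
Context {R : realType} {N : nat} {G : groupTopologicalType}.
Variable A : atlas R N G.

Definition lie_group : Prop :=
  [/\ smooth_manifold A,
      smooth_map A A (fun g : G => g^-1)%g,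
      continuous (fun gh : G * G => (gh.1 * gh.2)%g)
    & forall i j k : chart A,
      smooth_on
        [set z : 'cV[R]_N * 'cV[R]_N | exists g h : G,
          [/\ dom i g, dom j h, dom k (g * h)%g & z = (coord i g, coord j h)]]
        (fun z => coord k (par i z.1 * par j z.2)%g)].

Definition left_invariant_endo (J : endo_field A) : Prop :=
  forall g : G, holomorphic (fun h : G => g * h)%g J J.

Definition left_invariant_form (k : nat) (w : cform A k) : Prop :=
  forall g : G, is_pullback (fun h : G => g * h)%g w w.

End LieGroup.

Section Quotient.
Context {G : groupTopologicalType}.
Variable Gam : groupClosed G.

Definition coset_rel : rel G := fun g h => (h / g)%g \in Gam.

Lemma coset_rel_equiv : equiv_class_of coset_rel.
Proof.
split => [g|g h|h g k]; rewrite /coset_rel.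
- by rewrite mulgV gpred1.
- by rewrite -[in RHS]gpredV invgF.
- move=> gh hk; have -> : (k / g = (k / h) * (h / g))%g by rewrite mulgA mulgVK.
  exact: gpredM.
Qed.

Canonical coset_equiv := EquivRelPack coset_rel_equiv.

(* The space Gam\G of cosets Gam g, with the quotient topology. *)
Definition coset_space : topologicalType :=
  quotient_topology {eq_quot coset_equiv}.

Definition coset_pi (g : G) : coset_space :=
  (\pi_({eq_quot coset_equiv}) g)%qT.

Definition uniform_lattice : Prop :=
  [set` Gam] `<=` isolated [set` Gam] /\ compact [set: coset_space].

Section QuotientAtlas.
Context {R : realType} {N : nat}.
Variable A : atlas R N G.

(* A chart of A restricted to an open set on which the projection is
   injective, and hence pushed down to Gam\G. *)
Record quotient_chart := QuotientChart {
  qchart : chart A;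
  qset : set G;
  qset_open : open qset;
  qset_sub : qset `<=` dom qchart;
  qset_inj : {in qset &, injective coset_pi}
}.

Definition qsection (c : quotient_chart) (q : coset_space) : G :=
  xget 1%g [set g | qset c g /\ coset_pi g = q].

Definition quotient_atlas : atlas R N coset_space :=
  {| chart := quotient_chart;
     dom := fun c => coset_pi @` qset c;
     coord := fun c => coord (qchart c) \o qsection c;
     par := fun c => coset_pi \o par (qchart c) |}.

(* The field induced on Gam\G by a left invariant J: it has the same local
   expressions as J. *)
Definition quotient_endo (J : endo_field A) : endo_field quotient_atlas :=
  fun c => J (qchart c).

Definition invariant_form (k : nat) (s : cform quotient_atlas k) : Prop :=
  exists w : cform A k,
    [/\ differential_form w, left_invariant_form w & is_pullback coset_pi s w].

End QuotientAtlas.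
End Quotient.

Arguments quotient_endo {G} Gam {R N A} J.

(* Main.v *)
Require Import Defs.
From mathcomp Require Import all_boot all_order all_algebra fingroup perm.
From mathcomp Require Import all_classical all_reals all_analysis.
From mathcomp Require Import generic_quotient complex ring lra.

(** Let [s] be the invariant closed (m,0)-form for I = J_al, let J = J_(al+1), and
    let H be the quaternions spanned by 1, I, J, IJ.  Given a unit vector a there is
    T <> 0 in H, with constant coefficients, such that T J_a = I T; then
    T^*s = s(T., ..., T.) is a nowhere vanishing (m,0)-form for J_a, and only its
    closedness is at stake.

    At a given point, the Obata connection provides a torsion-free nabla that
    annihilates H, so d(T^*s)(v) is the alternation of (nabla_{S w_l} s)(w) at
    w = T v, with S = T^-1.  This expression is linear in S, and S runs through H,
    so it suffices to treat T = 1, I, J, IJ.  For T = I one has I^*s = i^m s.  For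
    T = J, both J^*s and the conjugate of s are of type (0,m), hence proportional,
    with a constant factor by left invariance; so J^*s is closed, and
    likewise (IJ)^*s. *)

Set Implicit Arguments.
Unset Strict Implicit.
Unset Printing Implicit Defensive.

Import Order.TTheory GRing.Theory Num.Theory.
Import numFieldNormedType.Exports.
Local Open Scope classical_set_scope.
Local Open Scope ring_scope.

(** * Alternating multilinear forms *)

Section RealMultilinear.
Context {R : realType} {N : nat}.
Local Notation V := 'cV[R]_N.

(** The obstacle is that [T] has constant coefficients but is not constant as a matrix, since I and
    J vary with the point; so pulling back by [T] does not commute with constant-coefficient
    differentiation. A connection for which [T] is parallel absorbs the derivatives of [T], and as
    [T] mixes I, J and IJ, all of H has to be parallel. The connection terms that remain are
    symmetric in two arguments because the torsion vanishes, and alternation kills them. Linearity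
    in S is of use only for a fixed w. This is available: each of the four base quaternions is
    invertible, so its v can be chosen to reach any prescribed w; and S, a multiple of the conjugate
    of [T], is a real combination of the four conjugates. Invariance of s matters for the factor
    between J^*s and the conjugate of s: were it a nonconstant function, its differential would
    appear in d(J^*s). No global connection is built. Its coefficients at a point are a formula in
    I, J and their first derivatives, and torsion-freeness and parallelism become linear identities
    between matrices. *)

Definition rmultilinear (k : nat) (f : ('I_k -> V) -> R) : Prop :=
  forall v l (a : R) u u',
    f (replace v l (a *: u + u')) = a * f (replace v l u) + f (replace v l u').

Definition ralternating (k : nat) (f : ('I_k -> V) -> R) : Prop :=
  forall v l l', l != l' -> v l = v l' -> f v = 0.

Lemma replace_id (k : nat) (v : 'I_k -> V) l : replace v l (v l) = v.
Proof. by apply/funext => j; rewrite /replace; case: eqP => [->|]. Qed.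

Lemma replaceC (k : nat) (v : 'I_k -> V) l l' u u' : l != l' ->
  replace (replace v l u) l' u' = replace (replace v l' u') l u.
Proof.
move=> ll'; apply/funext => j; rewrite /replace.
by case: (eqVneq j l') => // ->; rewrite eq_sym (negbTE ll').
Qed.

Lemma replace_replace (k : nat) (v : 'I_k -> V) l u u' :
  replace (replace v l u) l u' = replace v l u'.
Proof. by apply/funext => j; rewrite /replace; case: eqP. Qed.

Lemma mulmx_replace (k : nat) (T : 'M[R]_N) (v : 'I_k -> V) l u :
  (fun j => T *m replace v l u j) = replace (fun j => T *m v j) l (T *m u).
Proof. by apply/funext => j; rewrite /replace; case: ifP. Qed.

Section Fixed.
Variables (k : nat) (f : ('I_k -> V) -> R).
Hypothesis fM : rmultilinear f.

Lemma rmultilinear0 v l : f (replace v l 0) = 0.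
Proof. by have := fM v l (-1) 0 0; rewrite scaler0 addr0 mulN1r addNr. Qed.

Lemma rmultilinearD v l u u' :
  f (replace v l (u + u')) = f (replace v l u) + f (replace v l u').
Proof. by have := fM v l 1 u u'; rewrite scale1r mul1r. Qed.

Lemma rmultilinearZ v l a u : f (replace v l (a *: u)) = a * f (replace v l u).
Proof. by have := fM v l a u 0; rewrite addr0 rmultilinear0 addr0. Qed.

Lemma rmultilinear_sum v l (n : nat) (a : 'I_n -> R) (b : 'I_n -> V) :
  f (replace v l (\sum_j a j *: b j)) = \sum_j a j * f (replace v l (b j)).
Proof.
apply: (big_ind2 (fun u x => f (replace v l u) = x)) => [|u x u' x' <- <-|j _].
- exact: rmultilinear0.
- exact: rmultilinearD.
- exact: rmultilinearZ.
Qed.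

End Fixed.

(** Induction on the number of slots, splitting off slot 0. The expansion turns a form with varying
    arguments into a finite sum of products of scalar functions; the Leibniz rule, smoothness, and
    vanishing on a spanning family are all read off from it. *)
Lemma rmultilinear_expand (k n : nat) (f : ('I_k -> V) -> R)
    (a : 'I_k -> 'I_n -> R) (b : 'I_n -> V) (v : 'I_k -> V) :
  rmultilinear f -> (forall l, v l = \sum_j a l j *: b j) ->
  f v = \sum_(p : {ffun 'I_k -> 'I_n}) (\prod_l a l (p l)) * f (b \o p).
Proof.
elim: k f a v => [|k IH] f a v fM va.
  have E (p : {ffun 'I_0 -> 'I_n}) : b \o p = v by apply/funext => -[].
  under eq_bigr do rewrite big_ord0 mul1r E.
  by rewrite big_const card_ffun !card_ord iterS addr0.
pose ext u (w : 'I_k -> V) l := if unlift ord0 l is Some l' then w l' else u.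
have ext_replace u w l x :
    ext u (replace w l x) = replace (ext u w) (lift ord0 l) x.
  apply/funext => j; rewrite /ext /replace.
  case: unliftP => [j' ->|->]; first by rewrite (inj_eq lift_inj).
  by rewrite eqE.
have fext u : rmultilinear (fun w => f (ext u w)).
  by move=> w l c x x'; rewrite !ext_replace fM.
have E0 : f v = \sum_j a ord0 j * f (replace v ord0 (b j)).
  by rewrite -rmultilinear_sum // -va replace_id.
(* A choice function on [k.+1] slots is the same as its value at slot 0 together with a choice
   function on the other slots. *)
pose h (q : 'I_n * {ffun 'I_k -> 'I_n}) : {ffun 'I_k.+1 -> 'I_n} :=
  [ffun l => if unlift ord0 l is Some l' then q.2 l' else q.1].
have hK : bijective h.
  exists (fun p : {ffun 'I_k.+1 -> 'I_n} => (p ord0, [ffun l => p (lift ord0 l)])).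
    move=> [j q]; congr pair; first by rewrite ffunE unlift_none.
    by apply/ffunP => l; rewrite !ffunE liftK.
  move=> p; apply/ffunP => l; rewrite !ffunE.
  by case: unliftP => [l' ->|->]; rewrite ?ffunE.
rewrite (reindex h) /=; last exact: onW_bij.
rewrite -(pair_bigA _ (fun j (q : {ffun 'I_k -> 'I_n}) => (\prod_l a l (h (j, q) l))
   * f (b \o h (j, q)))) /= E0.
apply: eq_bigr => j _.
have -> : replace v ord0 (b j) = ext (b j) (fun l => v (lift ord0 l)).
  apply/funext => l; rewrite /replace /ext.
  by case: unliftP => [l' ->|->] //; rewrite eqE.
rewrite (IH _ (fun l => a (lift ord0 l)) _ (fext _)) => [|l]; last exact: va.
rewrite big_distrr; apply: eq_bigr => q _ /=; rewrite mulrA; congr (_ * _).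
  rewrite big_ord_recl ffunE unlift_none; congr (_ * _).
  by apply: eq_bigr => l _; rewrite ffunE liftK.
congr f; apply/funext => l; rewrite /ext /= ffunE.
by case: unliftP.
Qed.

Section Alternating.
Variables (k : nat) (f : ('I_k -> V) -> R).
Hypotheses (fM : rmultilinear f) (fA : ralternating f).

Lemma ralternating_tperm v i j : i != j -> f (v \o tperm i j) = - f v.
Proof.
move=> ij; have fD0 u u' w : f (replace (replace w i (u + u')) j (u + u')) = 0.
  by apply: (@fA _ i j) => //; rewrite /replace (negbTE ij) !eqxx.
have f0 u w : f (replace (replace w i u) j u) = 0.
  by apply: (@fA _ i j) => //; rewrite /replace (negbTE ij) !eqxx.
have := fD0 (v i) (v j) v.
rewrite rmultilinearD // ![replace (replace v i _) j _]replaceC //.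
rewrite !rmultilinearD // ![replace (replace v j _) i _]replaceC 1?eq_sym //.
rewrite !f0 add0r addr0 => /eqP; rewrite addr_eq0 => /eqP E.
rewrite !replace_id in E.
have -> : v \o tperm i j = replace (replace v i (v j)) j (v i).
  apply/funext => l; rewrite /replace /=.
  by case: tpermP => [->|->|/eqP/negbTE -> /eqP/negbTE ->] //;
     rewrite eqxx ?(negbTE ij).
exact: E.
Qed.

Lemma ralternating_perm v (s : 'S_k) : f (v \o s) = (-1) ^+ s * f v.
Proof.
have [ts -> /allP ts_ok] := prod_tpermP s.
elim: ts ts_ok v => [|t ts IH] ok v.
  rewrite big_nil odd_perm1 mul1r; congr f.
  by apply/funext => l; rewrite /= perm1.
have tt : t.1 != t.2 by apply: ok; rewrite mem_head.
rewrite big_cons odd_mul_tperm tt /=.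
have -> : v \o (tperm t.1 t.2 * \prod_(i <- ts) tperm i.1 i.2)%g =
    (v \o (\prod_(i <- ts) tperm i.1 i.2)%g) \o tperm t.1 t.2.
  by apply/funext => l /=; rewrite permM.
rewrite ralternating_tperm // IH => [|x xts]; last first.
  by apply: ok; rewrite in_cons xts orbT.
by rewrite signrN mulNr.
Qed.

(** Both sides evaluate [f] on the same vectors, those of [w] with index [b] left out, in different
    orders. The reordering [s] is what [tperm a b] induces between the complements of [a] and [b],
    so [odd a (+) odd b (+) s] is the parity of a transposition; this gives the sign. *)
Lemma ralternating_lift (w : 'I_k.+1 -> V) (a b : 'I_k.+1) : a != b ->
  (-1) ^+ a * f (w \o tperm a b \o lift a) = - ((-1) ^+ b * f (w \o lift b)).
Proof.
move=> ab; pose s' := (tperm a b * lift_perm b a 1)%g.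
have s'a : s' a = a by rewrite permM tpermL lift_perm_id.
pose g j := odflt j (unlift a (s' (lift a j))).
have gE j : lift a (g j) = s' (lift a j).
  rewrite /g; case: unliftP => //= /esym.
  by rewrite -[in LHS]s'a => /perm_inj/eqP; rewrite (negbTE (neq_lift _ _)).
have g_inj : injective g.
  by move=> i j ij; apply/(@lift_inj _ a)/(@perm_inj _ s'); rewrite -(gE i) -(gE j) ij.
pose s := perm g_inj.
have tE : tperm a b = lift_perm a b s.
  have -> : tperm a b = (s' * lift_perm a b 1)%g.
    by rewrite -mulgA lift_permM !mulg1 lift_perm1 mulg1.
  have -> : s' = lift_perm a a s.
    apply/permP => j; case: (unliftP a j) => [j' ->|->].
      by rewrite lift_perm_lift -gE [s _]permE.
    by rewrite s'a lift_perm_id.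
  by rewrite lift_permM mulg1.
have -> : w \o tperm a b \o lift a = (w \o lift b) \o s.
  by apply/funext => j; rewrite /= tE lift_perm_lift.
rewrite ralternating_perm.
have : true = odd a (+) odd b (+) s.
  by rewrite -odd_lift_perm -tE odd_tperm ab.
rewrite -(signr_odd _ a) -(signr_odd _ b).
by case: (odd a); case: (odd b); case: (s : bool) => //= _;
   rewrite ?expr0 ?expr1; ring.
Qed.

(** This is where a vanishing torsion pays off: the terms for (l, l') and (l', l) carry the same
    vector [B l l'] and differ by one transposition, so they cancel in pairs. *)
Lemma ralternating_cancel (w : 'I_k.+1 -> V) (B : 'I_k.+1 -> 'I_k.+1 -> V) :
  (forall l l', B l l' = B l' l) ->
  \sum_(l < k.+1) (-1) ^+ l *
    \sum_(j < k) f (replace (w \o lift l) j (B l (lift l j))) = 0.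
Proof.
move=> Bsym.
(* Here [l] is the omitted argument and [l'] the one replaced. The diagonal is set to 0 so that the
   double sum runs over all pairs and can be exchanged. *)
pose X (l l' : 'I_k.+1) := if l == l' then 0 else
  (-1) ^+ l * f (replace w l' (B l l') \o lift l).
have XN l l' : X l l' = - X l' l.
  rewrite /X [l' == l]eq_sym; case: eqVneq => [|ll']; first by rewrite oppr0.
  rewrite -(ralternating_lift _ ll'); congr (_ * f _).
  apply/funext => j /=; rewrite /replace Bsym.
  case: tpermP => [/eqP||/eqP + /eqP/negbTE ->].
  - by rewrite eq_sym (negbTE (neq_lift _ _)).
  - by move=> ->; rewrite !eqxx.
  - by rewrite eq_sym (negbTE (neq_lift _ _)).
have -> : \sum_(l < k.+1) (-1) ^+ l *
    \sum_(j < k) f (replace (w \o lift l) j (B l (lift l j))) =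
    \sum_l \sum_l' X l l'.
  apply: eq_bigr => l _; rewrite [RHS](bigD1_ord l) //= {1}/X eqxx add0r.
  rewrite big_distrr; apply: eq_bigr => j _ /=.
  rewrite /X (negbTE (neq_lift _ _)); congr (_ * f _).
  apply/funext => j'; rewrite /replace /=.
  by rewrite (inj_eq lift_inj).
set S := (X in X = 0).
have : S = - S.
  rewrite {1}/S exchange_big -sumrN; apply: eq_bigr => l _.
  by rewrite -sumrN; apply: eq_bigr => l' _; exact: XN.
by move=> E; lra.
Qed.

End Alternating.
End RealMultilinear.

(** * The Obata connection at a point *)

Section ObataConnection.
Context {R : realType} {N : nat}.
Local Notation V := 'cV[R]_N.
Variables (I J : 'M[R]_N) (P Q : V -> 'M[R]_N).

(* The Obata connection [nabla_X Y = ([X,Y] + I[IX,Y] - J[X,JY] + IJ[IX,JY]) / 2]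
   on constant vector fields, with [P = DI] and [Q = DJ] at the point. *)
Definition obata (u v : V) : V :=
  2^-1 *: (I *m J *m (Q (I *m u) *m v - P (J *m v) *m u)
           - I *m (P v *m u) - J *m (Q u *m v)).

Hypotheses (P_lin : forall a u v, P (a *: u + v) = a *: P u + P v)
  (Q_lin : forall a u v, Q (a *: u + v) = a *: Q u + Q v).

Let PZ a u : P (a *: u) = a *: P u.
Proof.
have P0 : P 0 = 0 by have := P_lin (-1) 0 0; rewrite scaler0 addr0 scaleN1r addNr.
by rewrite -[a *: u]addr0 P_lin P0 addr0.
Qed.
Let QZ a u : Q (a *: u) = a *: Q u.
Proof.
have Q0 : Q 0 = 0 by have := Q_lin (-1) 0 0; rewrite scaler0 addr0 scaleN1r addNr.
by rewrite -[a *: u]addr0 Q_lin Q0 addr0.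
Qed.
Let PN u : P (- u) = - P u. Proof. by rewrite -scaleN1r PZ scaleN1r. Qed.
Let QN u : Q (- u) = - Q u. Proof. by rewrite -scaleN1r QZ scaleN1r. Qed.

Lemma obata_linearl a u u' v :
  obata (a *: u + u') v = a *: obata u v + obata u' v.
Proof.
rewrite /obata !(mulmxDr, mulmxBr, mulmxN) -!scalemxAr !(P_lin, Q_lin).
rewrite !(mulmxDl, mulmxDr, mulmxBr) -!(scalemxAl, scalemxAr).
by apply/matrixP => i j; rewrite !mxE; field.
Qed.

Hypotheses (II : I *m I = - 1%:M) (JJ : J *m J = - 1%:M)
  (JI : J *m I = - (I *m J)).
Hypotheses (PI : forall u, P u *m I + I *m P u = 0)
  (QJ : forall u, Q u *m J + J *m Q u = 0)
  (PQ : forall u, P u *m J + I *m Q u + (Q u *m I + J *m P u) = 0).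
Hypotheses
  (NI : forall u v, P (I *m u) *m v - P (I *m v) *m u
          - I *m (P u *m v - P v *m u) = 0)
  (NJ : forall u v, Q (J *m u) *m v - Q (J *m v) *m u
          - J *m (Q u *m v - Q v *m u) = 0).

Let IIx (x : V) : I *m (I *m x) = - x.
Proof. by rewrite mulmxA II mulNmx mul1mx. Qed.
Let JJx (x : V) : J *m (J *m x) = - x.
Proof. by rewrite mulmxA JJ mulNmx mul1mx. Qed.
Let JIx (x : V) : J *m (I *m x) = - (I *m (J *m x)).
Proof. by rewrite !mulmxA JI mulNmx. Qed.
Let PIx u (x : V) : P u *m (I *m x) = - (I *m (P u *m x)).
Proof. by apply/eqP; rewrite -addr_eq0 !mulmxA -mulmxDl PI mul0mx. Qed.
Let QJx u (x : V) : Q u *m (J *m x) = - (J *m (Q u *m x)).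
Proof. by apply/eqP; rewrite -addr_eq0 !mulmxA -mulmxDl QJ mul0mx. Qed.
Let PJx u (x : V) : P u *m (J *m x) =
  - (I *m (Q u *m x)) - Q u *m (I *m x) - J *m (P u *m x).
Proof.
apply/eqP; rewrite -!addrA -!opprD -addr_eq0 !mulmxA !addrA -!mulmxDl.
by rewrite -addrA PQ mul0mx.
Qed.
Let QIJx u (x : V) : Q u *m (I *m (J *m x)) = J *m (Q u *m (I *m x)).
Proof. by rewrite -[I *m (J *m x)]opprK -JIx mulmxN QJx opprK. Qed.

(* Normal forms: left factors among [1, I, J, IJ], and no right factor except [I]
   after [Q]. *)
Let normE := (mulmxDr, mulmxBr, mulmxN, mulNmx, @opprK V, PN, QN, IIx, JJx, JIx,
  PIx, QJx, PJx, QIJx).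

Let entryD (A B : V) i j : (A + B) i j = A i j + B i j. Proof. by rewrite mxE. Qed.
Let entryN (A : V) i j : (- A) i j = - A i j. Proof. by rewrite mxE. Qed.
Let entryZ c (A : V) i j : (c *: A) i j = c * A i j. Proof. by rewrite mxE. Qed.
Let entry0 i j : (0 : V) i j = 0. Proof. by rewrite mxE. Qed.
Let entryE := (entryD, entryN, entryZ, entry0).

(** The torsion of this connection is a linear combination of Nijenhuis tensors of I and J. The
    eight instances, some multiplied by I or J, supply the terms; once all are in normal form, the
    combination is found entry by entry. *)
Lemma obata_sym u v : obata u v = obata v u.
Proof.
have n1 := NI u v; have n2 := NJ u v.
have n3 := NI (J *m u) (J *m v); have n4 := NJ (I *m u) (I *m v).
have n5 := congr1 (mulmx J) (NI (J *m u) v).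
have n6 := congr1 (mulmx J) (NI u (J *m v)).
have n7 := congr1 (mulmx I) (NJ (I *m u) v).
have n8 := congr1 (mulmx I) (NJ u (I *m v)).
rewrite /obata; congr (_ *: _); rewrite -!mulmxA.
rewrite !mulmx0 !normE in n1 n2 n3 n4 n5 n6 n7 n8 *.
apply/matrixP => i j.
move: n1 n2 n3 n4 n5 n6 n7 n8 => /matrixP/(_ i j) n1 /matrixP/(_ i j) n2
  /matrixP/(_ i j) n3 /matrixP/(_ i j) n4 /matrixP/(_ i j) n5
  /matrixP/(_ i j) n6 /matrixP/(_ i j) n7 /matrixP/(_ i j) n8.
rewrite !entryE in n1 n2 n3 n4 n5 n6 n7 n8 *.
by lra.
Qed.

(** The left side is (nabla_u I) v. Integrability of I is essential here: two values of its
    Nijenhuis tensor, one of them multiplied by J, account for the whole expression. *)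
Lemma obata_parallel_I u v : P u *m v + obata u (I *m v) - I *m obata u v = 0.
Proof.
have n1 := NI u (I *m v); have n2 := congr1 (mulmx J) (NI u (I *m (J *m v))).
rewrite /obata -scalemxAr -!mulmxA.
rewrite ?mulmx0 !normE in n1 n2 *.
apply/matrixP => i j.
move: n1 n2 => /matrixP/(_ i j) n1 /matrixP/(_ i j) n2.
rewrite !entryE in n1 n2 *.
by lra.
Qed.

(** The formula reads nabla_X = (A_X - J A_X J)/2 with A_X Y = [X,Y] + I[IX,Y]. Being an average
    over conjugation by J, it commutes with J, and integrability does not enter. *)
Lemma obata_parallel_J u v : Q u *m v + obata u (J *m v) - J *m obata u v = 0.
Proof.
rewrite /obata -scalemxAr -!mulmxA !normE.
apply/matrixP => i j; rewrite !entryE.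
by lra.
Qed.

(** Leibniz rule for a product of two parallel endomorphisms. *)
Lemma obata_parallel_IJ u v :
  (P u *m J + I *m Q u) *m v + obata u (I *m J *m v) - I *m J *m obata u v = 0.
Proof.
have eI := obata_parallel_I u (J *m v).
have eJ := congr1 (mulmx I) (obata_parallel_J u v).
rewrite mulmx0 mulmxBr mulmxDr in eJ.
rewrite mulmxDl -!mulmxA; rewrite -[RHS](addr0 0) -[X in _ = X + _]eI -eJ.
by apply/matrixP => i j; rewrite !entryE; ring.
Qed.

End ObataConnection.

(** * Calculus *)

Section Calculus.
Context {R : realType} {V : normedModType R}.

Lemma is_derive_prod (k : nat) (c : 'I_k -> V -> R) (dc : 'I_k -> R) (x v : V) :
  (forall l, is_derive x v (c l) (dc l)) ->
  is_derive x v (fun y => \prod_l c l y)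
    (\sum_l \prod_l' (if l' == l then dc l' else c l' x)).
Proof.
elim: k c dc => [|k IH] c dc cd.
  rewrite big_ord0 (_ : (fun _ => _) = cst 1); first exact: is_derive_cst.
  by apply/funext => y; rewrite big_ord0.
have {}IH := IH (fun l => c (lift ord0 l)) (fun l => dc (lift ord0 l))
  (fun l => cd (lift ord0 l)).
rewrite (_ : (fun y => _) = c ord0 * (fun y => \prod_l c (lift ord0 l) y)); last first.
  by apply/funext => y; rewrite big_ord_recl.
apply: is_derive_eq; rewrite addrC big_ord_recl /=; congr (_ + _).
  by rewrite big_ord_recl eqxx mulrC; congr (_ * _).
rewrite scaler_sumr; apply: eq_bigr => l _.
by rewrite big_ord_recl /=; congr (_ * _).
Qed.

Section Matrices.
Context {m n p : nat}.

Lemma derive_entry (A : V -> 'M[R]_(m, n)) x v i j : derivable A x v ->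
  is_derive x v (fun y => A y i j) (('D_v A x) i j).
Proof.
move=> dA; rewrite derive_mx // mxE; apply: derivableP.
exact: (derivable_mxP _ _ _).1.
Qed.

Lemma is_derive_entries (A : V -> 'M[R]_(m, n)) (dA : 'M[R]_(m, n)) x v :
  (forall i j, is_derive x v (fun y => A y i j) (dA i j)) -> is_derive x v A dA.
Proof.
move=> AE; have A' : derivable A x v by apply/derivable_mxP => i j.
apply: DeriveDef => //; rewrite derive_mx //.
by apply/matrixP => i j; rewrite mxE derive_val.
Qed.

End Matrices.

Lemma is_derive_mulmx m n p (A : V -> 'M[R]_(m, n)) (B : V -> 'M[R]_(n, p)) dA dB x v :
  is_derive x v A dA -> is_derive x v B dB ->
  is_derive x v (fun y => A y *m B y) (dA *m B x + A x *m dB).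
Proof.
move=> [dvA <-] [dvB <-]; apply: is_derive_entries => i j.
have eA l := derive_entry i l dvA; have eB l := derive_entry l j dvB.
rewrite (_ : (fun y => _) =
    \sum_l ((fun y => A y i l) * (fun y => B y l j))); last first.
  by apply/funext => y; rewrite mxE fct_sumE.
apply: is_derive_eq; rewrite !mxE -big_split /=; apply: eq_bigr => l _.
rewrite addrC; congr (_ + _); exact: mulrC.
Qed.

End Calculus.

Lemma near_eq_differentiable {R : realType} {V W : normedModType R}
    (f g : V -> W) x :
  (\forall y \near x, f y = g y) -> differentiable f x -> differentiable g x.
Proof.
move=> fg df; have dg : g \o shift x = cst (g x) + 'd f x +o_ 0 id.
  apply/eqaddoP => e e0.
  have /eqaddoP/(_ e e0) := diff_locally df.
  have : \forall h \near 0, f (h + x) = g (h + x).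
    by have /nbhs0P := fg; apply: filterS => h; rewrite addrC.
  apply: filterS2 => h /=.
  by rewrite !fctE /= => <-; rewrite -(nbhs_singleton fg).
have dE := diff_unique (diff_continuous df) dg.
apply/diff_locallyP; rewrite dE; split => //; exact: diff_continuous.
Unshelve. all: by end_near. Qed.

Section SmoothReal.
Context {R : realType} {V : normedModType R}.
Implicit Types U : set V.

Lemma Ck_ext (W : normedModType R) k U (f g : V -> W) : open U ->
  {in U, f =1 g} -> Ck k U f -> Ck k U g.
Proof.
move=> Uo; elim: k f g => [|k IH] f g fg.
  move=> /= fc x Ux; have fgx : \forall y \near x, f y = g y.
    by near=> y; apply: fg; rewrite inE; near: y; exact: open_nbhs_nbhs.
  have : f y @[y --> x] --> f x := fc x Ux.
  rewrite (nbhs_singleton fgx) => fcx.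
  by apply: (cvg_trans _ fcx); exact: near_eq_cvg.
have near_fg x : U x -> \forall y \near x, f y = g y.
  by move=> Ux; near=> y; apply: fg; rewrite inE; near: y; exact: open_nbhs_nbhs.
move=> /= [fd fD]; split => [x Ux|v].
  exact: near_eq_differentiable (near_fg _ Ux) (fd _ Ux).
apply: IH (fD v) => x; rewrite inE => Ux.
exact/near_eq_derive/near_fg.
Unshelve. all: by end_near. Qed.

Lemma Ck_sub (W : normedModType R) k U U' (f : V -> W) :
  U `<=` U' -> Ck k U' f -> Ck k U f.
Proof.
move=> UU'; elim: k f => [|k IH] f /=; first by move=> fc x /UU'; exact: fc.
by move=> [fd fD]; split => [x /UU'|v]; [exact: fd|exact/IH/fD].
Qed.

Lemma CkW (W : normedModType R) k U (f : V -> W) : Ck k.+1 U f -> Ck k U f.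
Proof.
elim: k f => [|k IH] f [fd fD].
  by move=> x Ux; apply: differentiable_continuous; exact: fd.
by split => // v; exact/IH/fD.
Qed.

Lemma Ck_cst (W : normedModType R) k U (c : W) : Ck k U (cst c).
Proof.
elim: k c => [|k IH] c /=; first by move=> x _; exact: cst_continuous.
split => [x _|v]; first exact: differentiable_cst.
by rewrite (_ : (fun x => _) = cst 0) //; apply/funext => x; rewrite derive_cst.
Qed.

Lemma CkD k U (f g : V -> R) : open U -> Ck k U f -> Ck k U g -> Ck k U (f + g).
Proof.
move=> Uo; elim: k f g => [|k IH] f g /=.
  by move=> fc gc x Ux; apply: continuousD; [exact: fc|exact: gc].
move=> [fd fD] [gd gD]; split => [x Ux|v].
  by apply: differentiableD; [exact: fd|exact: gd].
apply: (Ck_ext Uo _ (IH _ _ (fD v) (gD v))) => x; rewrite inE => Ux.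
by rewrite deriveD //; apply: diff_derivable; [exact: fd|exact: gd].
Qed.

Lemma CkM k U (f g : V -> R) : open U -> Ck k U f -> Ck k U g -> Ck k U (f * g).
Proof.
move=> Uo; elim: k f g => [|k IH] f g.
  by move=> fc gc x Ux; apply: continuousM; [exact: fc|exact: gc].
move=> fk gk; have [fd fD] := fk; have [gd gD] := gk; split => [x Ux|v].
  by apply: differentiableM; [exact: fd|exact: gd].
apply: (Ck_ext Uo _ (CkD Uo (IH _ _ (CkW fk) (gD v)) (IH _ _ (CkW gk) (fD v)))).
move=> x; rewrite inE => Ux.
by rewrite deriveM //; apply: diff_derivable; [exact: fd|exact: gd].
Qed.

Lemma Ck_sum (I : Type) (r : seq I) k U (F : I -> V -> R) : open U ->
  (forall i, Ck k U (F i)) -> Ck k U (fun x => \sum_(i <- r) F i x).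
Proof.
move=> Uo FC; rewrite -fct_sumE.
by elim/big_ind : _ => [|f g fC gC|i _] //; [exact: Ck_cst|exact: CkD].
Qed.

Lemma Ck_prod (I : Type) (r : seq I) k U (F : I -> V -> R) : open U ->
  (forall i, Ck k U (F i)) -> Ck k U (fun x => \prod_(i <- r) F i x).
Proof.
move=> Uo FC; rewrite -fct_prodE.
by elim/big_ind : _ => [|f g fC gC|i _] //; [exact: Ck_cst|exact: CkM].
Qed.

Lemma Ck_entry m n k U (f : V -> 'M[R]_(m, n)) i j : open U ->
  Ck k U f -> Ck k U (fun x => f x i j).
Proof.
move=> Uo; elim: k f => [|k IH] f /=.
  move=> fc x Ux; apply: (@continuous_comp _ _ _ f (fun A => A i j)).
    exact: fc.
  exact: coord_continuous.
move=> [fd fD]; split => [x Ux|v].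
  apply: (@differentiable_comp _ _ _ _ f (fun A => A i j)); first exact: fd.
  exact: differentiable_coord.
apply: (Ck_ext Uo _ (IH _ (fD v))) => x; rewrite inE => Ux.
by rewrite derive_mx ?mxE //; apply: diff_derivable; exact: fd.
Qed.

End SmoothReal.

(** * Exterior derivatives and parallel pullbacks *)

Lemma derive_linear {R : realType} {V W : normedModType R} (f : V -> W) x a u v :
  differentiable f x -> 'D_(a *: u + v) f x = a *: 'D_u f x + 'D_v f x.
Proof. by move=> df; rewrite !deriveE // linearP. Qed.

Section ExteriorDerivative.
Context {R : realType} {N : nat}.
Local Notation V := 'cV[R]_N.

Lemma is_derive_multilinear k (F : V -> ('I_k -> V) -> R) (X : V -> 'I_k -> V)
    (x v : V) :
  (\forall y \near x, rmultilinear (F y)) ->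
  (forall u, derivable (F^~ u) x v) -> (forall l, derivable (X^~ l) x v) ->
  is_derive x v (fun y => F y (X y))
    ('D_v (F^~ (X x)) x +
     \sum_l F x (replace (X x) l ('D_v (X^~ l) x))).
Proof.
move=> FM dF dX; have FMx := nbhs_singleton FM.
pose e (j : 'I_N) : V := delta_mx j 0.
have eE (u : V) : u = \sum_j u j 0 *: e j.
  by rewrite [LHS]matrix_sum_delta; apply: eq_bigr => j _; rewrite big_ord1.
have FE y u : rmultilinear (F y) -> F y u =
    \sum_(p : {ffun 'I_k -> 'I_N}) (\prod_l u l (p l) 0) * F y (e \o p).
  move=> FyM; apply: (rmultilinear_expand (a := fun l j => u l j 0) FyM) => l.
  exact: eE.
pose G (p : {ffun 'I_k -> 'I_N}) : V -> R :=
  (fun y => \prod_l X y l (p l) 0) * (F^~ (e \o p)).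
have GE : \forall y \near x, \sum_(p : {ffun 'I_k -> 'I_N}) G p y = F y (X y).
  by near=> y; rewrite [RHS]FE //; near: y.
apply: near_eq_is_derive GE _.
pose dX' l := 'D_v (X^~ l) x.
pose c p := \sum_l \prod_l' (if l' == l then dX' l' (p l') 0 else X x l' (p l') 0).
pose dG (p : {ffun 'I_k -> 'I_N}) : R :=
  (\prod_l X x l (p l) 0) *: 'D_v (F^~ (e \o p)) x + F x (e \o p) *: c p.
have GD p : is_derive x v (G p) (dG p).
  have dc : is_derive x v (fun y => \prod_l X y l (p l) 0) (c p).
    by apply: is_derive_prod => l; exact: derive_entry.
  have dFp : is_derive x v (F^~ (e \o p)) ('D_v (F^~ (e \o p)) x).
    exact: derivableP.
  exact: is_deriveM.
have sumG : is_derive x v (fun y => \sum_p G p y) (\sum_p dG p).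
  rewrite -fct_sumE; elim/big_ind2 : _ => [|f df g dg ? ?|p _]; last exact: GD.
    exact: is_derive_cst.
  exact: is_deriveD.
(* The first half of [dG] sums to the derivative of [F] with arguments frozen at [X x]; the second
   half, regrouped by slot, is the expansion of [F x] with that one slot differentiated. *)
apply: is_derive_eq sumG _; rewrite big_split /=; congr (_ + _).
  have FXE : \forall y \near x, F y (X x) =
      \sum_(p : {ffun 'I_k -> 'I_N}) (\prod_l X x l (p l) 0) * F y (e \o p).
    by near=> y; apply: FE; near: y.
  rewrite (near_eq_derive _ FXE) -fct_sumE.
  have D p : is_derive x v (fun y => (\prod_l X x l (p l) 0) * F y (e \o p))
     ((\prod_l X x l (p l) 0) *: 'D_v (F^~ (e \o p)) x).
    apply: is_deriveZ; exact: derivableP.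
  have sumD : is_derive x v
      (\sum_(p : {ffun 'I_k -> 'I_N}) (fun y => (\prod_l X x l (p l) 0) * F y (e \o p)))
      (\sum_(p : {ffun 'I_k -> 'I_N}) (\prod_l X x l (p l) 0) *: 'D_v (F^~ (e \o p)) x).
    elim/big_ind2 : _ => [|f df g dg ? ?|p _]; last exact: D.
      exact: is_derive_cst.
    exact: is_deriveD.
  by rewrite derive_val.
under eq_bigr do rewrite scaler_sumr.
rewrite exchange_big; apply: eq_bigr => l _ /=.
rewrite [RHS]FE //; apply: eq_bigr => p _.
rewrite [LHS]mulrC; congr (_ * _); apply: eq_bigr => l' _.
by rewrite /replace; case: eqP => [->|].
Unshelve. all: by end_near. Qed.

Definition ext_derivativeR k (F : V -> ('I_k -> V) -> R) (x : V)
    (v : 'I_k.+1 -> V) : R :=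
  \sum_(l < k.+1) (-1) ^+ l * 'D_(v l) (F^~ (v \o lift l)) x.

(** The value of nabla_z F on fields that are constant in the coordinates. [Gam] stands for the
    connection coefficients, not for a lattice. *)
Definition cov_derivative k (Gam : V -> V -> V) (F : V -> ('I_k -> V) -> R)
    (x z : V) (u : 'I_k -> V) : R :=
  'D_z (F^~ u) x - \sum_j F x (replace u j (Gam z (u j))).

(* With [w = T v], [S = T^-1] and [T] parallel this is [d(T^*F)(v)]: the point is
   that it is linear in [S]. *)
Definition cov_ext k (Gam : V -> V -> V) (F : V -> ('I_k -> V) -> R) (x : V)
    (S : 'M[R]_N) (w : 'I_k.+1 -> V) : R :=
  \sum_(l < k.+1) (-1) ^+ l * cov_derivative Gam F x (S *m w l) (w \o lift l).

Section Pullback.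
Variables (k : nat) (F : V -> ('I_k -> V) -> R) (x : V) (Gam : V -> V -> V).
Hypotheses (FM : \forall y \near x, rmultilinear (F y))
  (FA : ralternating (F x)) (dF : forall u, differentiable (F^~ u) x).
Hypotheses (Gam_linear : forall a u u' v,
    Gam (a *: u + u') v = a *: Gam u v + Gam u' v)
  (Gam_sym : forall u v, Gam u v = Gam v u).

Let FMx := nbhs_singleton FM.

Lemma cov_derivative_linear a z z' u : cov_derivative Gam F x (a *: z + z') u =
  a * cov_derivative Gam F x z u + cov_derivative Gam F x z' u.
Proof.
rewrite /cov_derivative derive_linear //.
under eq_bigr do rewrite Gam_linear FMx.
by rewrite big_split -mulr_sumr /= mulrBr opprD addrACA.
Qed.

Lemma cov_ext_linear a S S' w :
  cov_ext Gam F x (a *: S + S') w = a * cov_ext Gam F x S w + cov_ext Gam F x S' w.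
Proof.
rewrite /cov_ext mulr_sumr -big_split; apply: eq_bigr => l _ /=.
by rewrite mulmxDl -scalemxAl cov_derivative_linear mulrDr mulrCA.
Qed.

(** By parallelism the derivative of T v_j along v_l is T Gam(v_l, v_j) - Gam(v_l, T v_j). The
    second term completes the derivative of [F] to a covariant one; the first is symmetric in l and
    j, so its alternation vanishes. The direction v_l is rewritten as S (T v_l). *)
Lemma ext_derivative_pullback (T : V -> 'M[R]_N) S v :
  differentiable T x -> S *m T x = 1%:M ->
  (forall u w, 'D_u T x *m w + Gam u (T x *m w) - T x *m Gam u w = 0) ->
  ext_derivativeR (fun y u => F y (fun j => T y *m u j)) x v =
  cov_ext Gam F x S (fun l => T x *m v l).
Proof.
move=> dT ST Tpar.
(* The vanishing alternation is added on the right, so that the two sides can be compared summand by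
   summand. *)
rewrite -[RHS]addr0 -(ralternating_cancel FMx FA (fun l => T x *m v l)
  (B := fun l l' => T x *m Gam (v l) (v l'))); last by move=> l l'; rewrite Gam_sym.
rewrite /cov_ext -big_split; apply: eq_bigr => l _ /=.
rewrite -mulrDr mulmxA ST mul1mx; congr (_ * _).
have dTv : derivable T x (v l) by exact: diff_derivable.
have XD j : is_derive x (v l) (fun y => T y *m v (lift l j))
    ('D_(v l) T x *m v (lift l j)).
  have := is_derive_mulmx (derivableP dTv) (is_derive_cst (v (lift l j)) x (v l)).
  by move=> h; apply: is_derive_eq h _; rewrite mulmx0 addr0.
have := @is_derive_multilinear _ F (fun y j => T y *m v (lift l j)) x (v l) FM
  (fun u => diff_derivable (dF u)) (fun j => @ex_derive _ _ _ _ _ _ _ (XD j)).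
move=> /@derive_val ->; rewrite /cov_derivative -addrA; congr (_ + _).
rewrite addrC -sumrB; apply: eq_bigr => j _.
have -> : 'D_(v l) (fun y => T y *m v (lift l j)) x =
    -1 *: Gam (v l) (T x *m v (lift l j)) + T x *m Gam (v l) (v (lift l j)).
  rewrite derive_val scaleN1r; apply/eqP; rewrite -subr_eq0 opprD opprK addrA.
  by rewrite Tpar.
by rewrite FMx mulN1r addrC.
Qed.

End Pullback.
End ExteriorDerivative.

(** * Pullback by quaternions *)

Section Quaternions.
Context {R : realType} {N : nat}.

Definition quat (I J : 'M[R]_N) (q0 q1 q2 q3 : R) : 'M[R]_N :=
  q0%:M + q1 *: I + q2 *: J + q3 *: (I *m J).

Variables I J : 'M[R]_N.
Hypotheses (II : I *m I = - 1%:M) (JJ : J *m J = - 1%:M)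
  (JI : J *m I = - (I *m J)).

Lemma quat_mul a0 a1 a2 a3 b0 b1 b2 b3 :
  quat I J a0 a1 a2 a3 *m quat I J b0 b1 b2 b3 =
  quat I J (a0 * b0 - a1 * b1 - a2 * b2 - a3 * b3)
    (a0 * b1 + a1 * b0 + a2 * b3 - a3 * b2)
    (a0 * b2 - a1 * b3 + a2 * b0 + a3 * b1)
    (a0 * b3 + a1 * b2 - a2 * b1 + a3 * b0).
Proof.
have IK : I *m (I *m J) = - J by rewrite mulmxA II mulNmx mul1mx.
have KJ : I *m J *m J = - I by rewrite -mulmxA JJ mulmxN mulmx1.
have JK : J *m (I *m J) = I by rewrite mulmxA JI mulNmx KJ opprK.
have KI : I *m J *m I = J by rewrite -mulmxA JI mulmxN IK opprK.
have KK : I *m J *m (I *m J) = - 1%:M by rewrite mulmxA KI.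
rewrite /quat !(mulmxDl, mulmxDr) !mul_scalar_mx !mul_mx_scalar.
rewrite -!scalemxAl -!scalemxAr KK KI KJ JK IK II JJ JI.
apply/matrixP => i j; move: (I *m J) => K; rewrite !mxE.
move: (I i j) (J i j) (K i j) => xI xJ xK.
by case: (i == j); rewrite ?mulr1n ?mulr0n; ring.
Qed.

Lemma quat_conj_mul q0 q1 q2 q3 :
  quat I J q0 (- q1) (- q2) (- q3) *m quat I J q0 q1 q2 q3 =
  (q0 ^+ 2 + q1 ^+ 2 + q2 ^+ 2 + q3 ^+ 2)%:M.
Proof.
rewrite quat_mul /quat.
have -> : q0 * q0 - - q1 * q1 - - q2 * q2 - - q3 * q3 =
  q0 ^+ 2 + q1 ^+ 2 + q2 ^+ 2 + q3 ^+ 2 by ring.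
have -> : q0 * q1 + - q1 * q0 + - q2 * q3 - - q3 * q2 = 0 by ring.
have -> : q0 * q2 - - q1 * q3 + - q2 * q0 + - q3 * q1 = 0 by ring.
have -> : q0 * q3 + - q1 * q2 - - q2 * q1 + - q3 * q0 = 0 by ring.
by rewrite !scale0r !addr0.
Qed.

End Quaternions.

Lemma differentiable_entry {R : realType} {V : normedModType R} m n
    (A : V -> 'M[R]_(m, n)) x i j :
  differentiable A x -> differentiable (fun y => A y i j) x.
Proof.
move=> dA; apply: (@differentiable_comp _ _ _ _ A (fun B => B i j)) => //.
exact: differentiable_coord.
Qed.

Lemma differentiable_entries {R : realType} {V : normedModType R} m n
    (A : V -> 'M[R]_(m, n)) x :
  (forall i j, differentiable (fun y => A y i j) x) -> differentiable A x.
Proof.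
move=> dA; rewrite (_ : A = \sum_i \sum_j (fun y => A y i j *: delta_mx i j)).
  do 2![apply: differentiable_sum => ?].
  exact: differentiableZl.
apply/funext => y; rewrite fct_sumE [LHS]matrix_sum_delta.
by apply: eq_bigr => i _; rewrite fct_sumE.
Qed.

Lemma differentiable_mulmx {R : realType} {V : normedModType R} m n p
    (A : V -> 'M[R]_(m, n)) (B : V -> 'M[R]_(n, p)) x :
  differentiable A x -> differentiable B x ->
  differentiable (fun y => A y *m B y) x.
Proof.
move=> dA dB; apply: differentiable_entries => i j.
rewrite (_ : (fun y => _) =
    \sum_l ((fun y => A y i l) * (fun y => B y l j))); last first.
  by apply/funext => y; rewrite mxE fct_sumE.
apply: differentiable_sum => l.
by apply: differentiableM; exact: differentiable_entry.
Qed.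

Section QuaternionicPullback.
Context {R : realType} {N : nat}.
Local Notation V := 'cV[R]_N.
Variables (I J : V -> 'M[R]_N) (x : V).
Hypotheses (dI : differentiable I x) (dJ : differentiable J x).
Hypotheses (II : \forall y \near x, I y *m I y = - 1%:M)
  (JJ : \forall y \near x, J y *m J y = - 1%:M)
  (JI : \forall y \near x, J y *m I y = - (I y *m J y)).
Hypotheses
  (NI : forall u v, 'D_(I x *m u) I x *m v - 'D_(I x *m v) I x *m u
          - I x *m ('D_u I x *m v - 'D_v I x *m u) = 0)
  (NJ : forall u v, 'D_(J x *m u) J x *m v - 'D_(J x *m v) J x *m u
          - J x *m ('D_u J x *m v - 'D_v J x *m u) = 0).

Let IIx := nbhs_singleton II.
Let JJx := nbhs_singleton JJ.
Let JIx := nbhs_singleton JI.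
Let isI u : is_derive x u I ('D_u I x).
Proof. exact/derivableP/diff_derivable. Qed.
Let isJ u : is_derive x u J ('D_u J x).
Proof. exact/derivableP/diff_derivable. Qed.

Definition obata_at := obata (I x) (J x) (fun u => 'D_u I x) (fun u => 'D_u J x).

Let DI_linear a u v : 'D_(a *: u + v) I x = a *: 'D_u I x + 'D_v I x.
Proof. exact: derive_linear. Qed.
Let DJ_linear a u v : 'D_(a *: u + v) J x = a *: 'D_u J x + 'D_v J x.
Proof. exact: derive_linear. Qed.

Let DII u : 'D_u I x *m I x + I x *m 'D_u I x = 0.
Proof.
rewrite -(@derive_val _ _ _ _ _ _ _ (is_derive_mulmx (isI u) (isI u))).
by rewrite (near_eq_derive _ II) derive_cst.
Qed.

Let DJJ u : 'D_u J x *m J x + J x *m 'D_u J x = 0.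
Proof.
rewrite -(@derive_val _ _ _ _ _ _ _ (is_derive_mulmx (isJ u) (isJ u))).
by rewrite (near_eq_derive _ JJ) derive_cst.
Qed.

Let DIJ u : 'D_u I x *m J x + I x *m 'D_u J x
  + ('D_u J x *m I x + J x *m 'D_u I x) = 0.
Proof.
have dIJ := is_derive_mulmx (isI u) (isJ u).
have dJI := is_derive_mulmx (isJ u) (isI u).
rewrite -(@derive_val _ _ _ _ _ _ _ dIJ) -(@derive_val _ _ _ _ _ _ _ dJI).
by rewrite (near_eq_derive _ JI) deriveN ?subrr //; exact: ex_derive.
Qed.

Lemma obata_at_linear a u u' v : obata_at (a *: u + u') v = a *: obata_at u v + obata_at u' v.
Proof. exact: obata_linearl. Qed.

Lemma obata_at_sym u v : obata_at u v = obata_at v u.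
Proof.
exact: (obata_sym (P := fun u => 'D_u I x) DJ_linear IIx JJx JIx DIJ NI NJ).
Qed.

Lemma quat_differentiable q0 q1 q2 q3 :
  differentiable (fun y => quat (I y) (J y) q0 q1 q2 q3) x.
Proof.
apply: differentiableD; last exact/differentiableZ/differentiable_mulmx.
apply: differentiableD; last exact: differentiableZ.
apply: differentiableD; last exact: differentiableZ.
exact: differentiable_cst.
Qed.

Lemma quat_parallel q0 q1 q2 q3 u w (T := fun y => quat (I y) (J y) q0 q1 q2 q3) :
  'D_u T x *m w + obata_at u (T x *m w) - T x *m obata_at u w = 0.
Proof.
have dT : is_derive x u T (q1 *: 'D_u I x + q2 *: 'D_u J x
    + q3 *: ('D_u I x *m J x + I x *m 'D_u J x)).
  have := is_deriveD (is_deriveD (is_deriveD (is_derive_cst q0%:M x u)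
    (is_deriveZ q1 (isI u))) (is_deriveZ q2 (isJ u)))
    (is_deriveZ q3 (is_derive_mulmx (isI u) (isJ u))).
  by rewrite add0r.
have pI : 'D_u I x *m w + obata_at u (I x *m w) - I x *m obata_at u w = 0.
  exact: (obata_parallel_I DI_linear IIx JJx JIx DII DIJ NI).
have pJ : 'D_u J x *m w + obata_at u (J x *m w) - J x *m obata_at u w = 0.
  exact: (obata_parallel_J DI_linear JJx JIx DJJ).
have pK : ('D_u I x *m J x + I x *m 'D_u J x) *m w
    + obata_at u (I x *m J x *m w) - I x *m J x *m obata_at u w = 0.
  exact: (obata_parallel_IJ DI_linear IIx JJx JIx DII DJJ DIJ NI).
rewrite derive_val /T /quat.
have GamZ a v : obata_at u (a *: v) = a *: obata_at u v.
  rewrite ![obata_at u _]obata_at_sym -[a *: v]addr0 obata_at_linear.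
  suff -> : obata_at 0 u = 0 by rewrite addr0.
  by have := obata_at_linear (-1) 0 0 u; rewrite scaler0 addr0 scaleN1r addNr.
have GamD v v' : obata_at u (v + v') = obata_at u v + obata_at u v'.
  have := obata_at_linear 1 v v' u; rewrite !scale1r !(obata_at_sym _ u); exact.
move: ('D_u I x *m J x + I x *m 'D_u J x) pK => DK pK.
rewrite !mulmxDl !mul_scalar_mx -!scalemxAl !GamD !GamZ.
have solve (a b c : V) : a + b - c = 0 -> a = c - b.
  by move/eqP; rewrite subr_eq0 => /eqP <-; rewrite addrK.
rewrite (solve _ _ _ pI) (solve _ _ _ pJ) (solve _ _ _ pK).
move: (obata_at u (I x *m w)) (obata_at u (J x *m w)) (obata_at u (I x *m J x *m w))
  (I x *m obata_at u w) (J x *m obata_at u w) (I x *m J x *m obata_at u w) (obata_at u w).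
by move=> *; apply/matrixP => i j; rewrite !mxE; ring.
Qed.

(** The exterior derivative equals [E S w] with S = T^-1 and w = T v, which is real linear in S.
    Each of the four hypotheses gives [E S w = 0] for one conjugate unit S and for every w, and
    these four S span the quaternions. *)
Lemma ext_derivative_quat k (F : V -> ('I_k -> V) -> R) (v : 'I_k.+1 -> V)
    (Fq := fun q0 q1 q2 q3 y u =>
       F y (fun l => quat (I y) (J y) q0 q1 q2 q3 *m u l)) :
  (\forall y \near x, rmultilinear (F y)) -> ralternating (F x) ->
  (forall u, differentiable (F^~ u) x) ->
  (forall v, ext_derivativeR (Fq 1 0 0 0) x v = 0) ->
  (forall v, ext_derivativeR (Fq 0 1 0 0) x v = 0) ->
  (forall v, ext_derivativeR (Fq 0 0 1 0) x v = 0) ->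
  (forall v, ext_derivativeR (Fq 0 0 0 1) x v = 0) ->
  forall q0 q1 q2 q3, q0 ^+ 2 + q1 ^+ 2 + q2 ^+ 2 + q3 ^+ 2 != 0 ->
  ext_derivativeR (Fq q0 q1 q2 q3) x v = 0.
Proof.
move=> FM FA dF F1 FI FJ FK q0 q1 q2 q3 q_neq0.
pose T := quat (I x) (J x); pose E := cov_ext obata_at F x.
pose n q0 q1 q2 q3 : R := q0 ^+ 2 + q1 ^+ 2 + q2 ^+ 2 + q3 ^+ 2.
have TT := quat_conj_mul IIx JJx JIx.
have EZ a S w : E (a *: S) w = a * E S w.
  have E0 : E 0 w = 0.
    have := cov_ext_linear FM dF obata_at_linear (-1) 0 0 w.
    by rewrite scaler0 addr0 mulN1r addNr.
  by have := cov_ext_linear FM dF obata_at_linear a S 0 w; rewrite addr0 -/E E0 addr0.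
have ED S S' w : E (S + S') w = E S w + E S' w.
  have := cov_ext_linear FM dF obata_at_linear 1 S S' w.
  by rewrite scale1r mul1r.
(* The inverse of a quaternion is its conjugate divided by its norm [n]; the scalar comes out by
   linearity. *)
have FE a0 a1 a2 a3 v' : n a0 a1 a2 a3 != 0 -> ext_derivativeR (Fq a0 a1 a2 a3) x v' =
    (n a0 a1 a2 a3)^-1 * E (T a0 (- a1) (- a2) (- a3)) (fun l => T a0 a1 a2 a3 *m v' l).
  move=> a_neq0; rewrite -EZ.
  apply: (ext_derivative_pullback FM FA dF obata_at_sym) => //.
  - exact: quat_differentiable.
  - by rewrite -scalemxAl TT scale_scalar_mx mulVf.
  - by move=> u w; exact: quat_parallel.
have E0 a0 a1 a2 a3 w : n a0 a1 a2 a3 = 1 ->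
    (forall v, ext_derivativeR (Fq a0 a1 a2 a3) x v = 0) ->
    E (T a0 (- a1) (- a2) (- a3)) w = 0.
  (* For norm 1 the conjugate is the inverse, so this choice of arguments is carried by the
     quaternion to the given [w]. *)
  move=> n1 Fa; have := Fa (fun l => T a0 (- a1) (- a2) (- a3) *m w l).
  rewrite FE n1 ?oner_neq0 // invr1 mul1r => <-; congr (E _ _).
  apply/funext => l; rewrite mulmxA.
  have := TT a0 (- a1) (- a2) (- a3); rewrite !opprK !sqrrN -/(n _ _ _ _) n1.
  by rewrite /T => ->; rewrite mul1mx.
rewrite FE //; set w := (fun l => _).
(* The signs [- 0] and [- 1] are kept so that each summand is literally the conjugate of a unit, as
   in [E0]. *)
have -> : T q0 (- q1) (- q2) (- q3) = q0 *: T 1 (- 0) (- 0) (- 0)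
    + q1 *: T 0 (- 1) (- 0) (- 0) + q2 *: T 0 (- 0) (- 1) (- 0)
    + q3 *: T 0 (- 0) (- 0) (- 1).
  have M0 : 0%:M = 0 :> 'M[R]_N by apply/matrixP => i j; rewrite !mxE mul0rn.
  rewrite /T /quat !oppr0 !scale0r !addr0 M0 !add0r.
  by rewrite !scaleNr !scale1r !scalerN scale_scalar_mx mulr1.
have [n0 n1 n2 n3] : [/\ n 1 0 0 0 = 1, n 0 1 0 0 = 1, n 0 0 1 0 = 1
  & n 0 0 0 1 = 1] by rewrite /n; split; ring.
rewrite !ED !EZ (E0 _ _ _ _ _ n0 F1) (E0 _ _ _ _ _ n1 FI).
by rewrite (E0 _ _ _ _ _ n2 FJ) (E0 _ _ _ _ _ n3 FK) !mulr0 !addr0 mulr0.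
Qed.

End QuaternionicPullback.

(** * Forms of type (m,0) at a point *)

Section ComplexForms.
Context {R : realType} {N : nat}.
Local Notation V := 'cV[R]_N.
Local Notation C := (R[i])%C.

Lemma Re_multilinear k (f : ('I_k -> V) -> C) :
  multilinear_form f -> rmultilinear (fun v => complex.Re (f v)).
Proof.
move=> fM v l a u u'; rewrite fM.
by case: (f _) => x y; case: (f _) => z t /=; ring.
Qed.

Lemma Im_multilinear k (f : ('I_k -> V) -> C) :
  multilinear_form f -> rmultilinear (fun v => complex.Im (f v)).
Proof.
move=> fM v l a u u'; rewrite fM.
by case: (f _) => x y; case: (f _) => z t /=; ring.
Qed.

Lemma Re_alternating k (f : ('I_k -> V) -> C) :
  alternating_form f -> ralternating (fun v => complex.Re (f v)).
Proof. by move=> fA v l l' ll' vl; rewrite (fA _ _ _ ll' vl). Qed.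

Lemma Im_alternating k (f : ('I_k -> V) -> C) :
  alternating_form f -> ralternating (fun v => complex.Im (f v)).
Proof. by move=> fA v l l' ll' vl; rewrite (fA _ _ _ ll' vl). Qed.

Lemma multilinear_alternating_perm0 k (f : ('I_k -> V) -> C) v (s : 'S_k) :
  multilinear_form f -> alternating_form f -> f v = 0 -> f (v \o s) = 0.
Proof.
move=> fM fA fv0; apply/eqP; rewrite eq_complex; apply/andP; split; apply/eqP.
  rewrite (ralternating_perm (Re_multilinear fM) (Re_alternating fA)).
  by rewrite fv0 /= mulr0.
rewrite (ralternating_perm (Im_multilinear fM) (Im_alternating fA)).
by rewrite fv0 /= mulr0.
Qed.

Lemma multilinear_spanning0 k n (f : ('I_k -> V) -> C) (b : 'I_n -> V) :
  multilinear_form f -> (forall u : V, exists a, u = \sum_j a j *: b j) ->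
  (forall p : 'I_k -> 'I_n, f (b \o p) = 0) -> forall v, f v = 0.
Proof.
move=> fM bspan fb0 v.
have /boolp.choice[a aE] : forall l, exists a, v l = \sum_j a j *: b j.
  by move=> l; exact: bspan.
apply/eqP; rewrite eq_complex; apply/andP; split; apply/eqP.
  rewrite (rmultilinear_expand (Re_multilinear fM) aE).
  by rewrite big1 // => p _; rewrite fb0 mulr0.
rewrite (rmultilinear_expand (Im_multilinear fM) aE).
by rewrite big1 // => p _; rewrite fb0 mulr0.
Qed.

Definition form_k0 (I : 'M[R]_N) k (f : ('I_k -> V) -> C) : Prop :=
  forall v l, f v + ('i)%C * f (replace v l (I *m v l)) = 0.

Lemma form_k0E I k (f : ('I_k -> V) -> C) v l u : form_k0 I f ->
  f (replace v l (I *m u)) = ('i)%C * f (replace v l u).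
Proof.
move=> fI; have := fI (replace v l u) l.
rewrite replace_replace (_ : replace v l u l = u); last by rewrite /replace eqxx.
case: (f _) => x y; case: (f _) => z t /eqP; rewrite eq_complex /=.
by move=> /andP[/eqP e1 /eqP e2]; apply/eqP; rewrite eq_complex /=;
   apply/andP; split; apply/eqP; lra.
Qed.

Section ComplexStructure.
Variable I : 'M[R]_N.
Hypothesis II : I *m I = - 1%:M.

(** (det I)^2 = (-1)^N cannot be negative over the reals. Thus the truncated half [N./2] used as
    degree is the true complex dimension. *)
Lemma even_dim : (N = N./2 + N./2)%N.
Proof.
rewrite addnn -[LHS]odd_double_half.
have : (\det I) ^+ 2 = (-1) ^+ N.
  by rewrite expr2 -det_mulmx II -scaleN1r detZ det1 mulr1.
rewrite -signr_odd; case: (odd N) => //= dI.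
by have := sqr_ge0 (\det I); rewrite dI expr1 oppr_ge0 ler10.
Qed.

(* A relation among the [e_i] and [I e_i], inserted in the slot [i], multiplies
   [f e] by the complex coefficient of [e_i]. *)
Lemma form_k0_basis (m : nat) (f : ('I_m -> V) -> C) (e : 'I_m -> V)
    (b := fun j : 'I_(m + m) =>
      match fintype.split j with inl i => e i | inr i => I *m e i end) :
  N = (m + m)%N -> multilinear_form f -> alternating_form f -> form_k0 I f ->
  f e != 0 -> forall u : V, exists a, u = \sum_j a j *: b j.
Proof.
move=> Nm fM fA fI fe u.
pose B : 'M[R]_(m + m, N) := \matrix_(j, i) b j i 0.
have BE (c : 'rV[R]_(m + m)) : (c *m B)^T = \sum_j c 0 j *: b j.
  apply/matrixP => i k; rewrite !mxE summxE; apply: eq_bigr => j _.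
  by rewrite !mxE (ord1 k).
have f0 v l : f (replace v l 0) = 0.
  have := fM v l (-1) 0 0; rewrite scaler0 addr0 rmorphN rmorph1 mulN1r.
  by rewrite addNr.
have fsum v l n (a : 'I_n -> R) (w : 'I_n -> V) :
    f (replace v l (\sum_j a j *: w j)) =
    \sum_j (a j)%:C%C * f (replace v l (w j)).
  elim/big_rec2 : _ => [|j x y _ <-]; first exact: f0.
  exact: fM.
have B_free : row_free B.
  apply: inj_row_free => c cB.
  have sum0 : \sum_j c 0 j *: b j = 0 by rewrite -BE cB trmx0.
  have c0 (i : 'I_m) : c 0 (lshift m i) = 0 /\ c 0 (rshift m i) = 0.
    have := fsum e i _ (c 0) b; rewrite sum0 f0 big_split_ord /=.
    have bl j : b (lshift m j) = e j by rewrite /b -[lshift m j]/(unsplit (inl j)) unsplitK.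
    have br j : b (rshift m j) = I *m e j by rewrite /b -[rshift m j]/(unsplit (inr j)) unsplitK.
    have fe0 j : j != i -> f (replace e i (e j)) = 0.
      move=> ji; apply: (fA _ i j); first by rewrite eq_sym.
      by rewrite /replace eqxx (negbTE ji).
    rewrite (bigD1 i) //= big1 => [|j ji]; last by rewrite bl fe0 ?mulr0.
    rewrite (bigD1 i) //= big1 => [|j ji]; last first.
      by rewrite br form_k0E // fe0 ?mulr0.
    rewrite bl br form_k0E // replace_id !addr0 mulrA -mulrDl => /esym/eqP.
    rewrite mulf_eq0 (negbTE fe) orbF eq_complex /= => /andP[/eqP h1 /eqP h2].
    by split; lra.
  apply/rowP => j; rewrite mxE; case: (split_ordP j) => i -> ; by case: (c0 i).
have : (u^T <= B)%MS by rewrite submx_full // /row_full (eqnP B_free) Nm.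
by move=> /submxP[D uD]; exists (D 0); rewrite -BE -uD trmxK.
Qed.

(** The (m,0)-forms at a point make up a complex line. The difference [h] vanishes on [e], hence on
    every choice of vectors from [e] (by a permutation or a repetition), hence also with I inserted
    in any set of slots, which only multiplies by powers of i; and the e_i and I e_i span. *)
Lemma form_k0_proportional (m : nat) (f g : ('I_m -> V) -> C) (e : 'I_m -> V) :
  N = (m + m)%N -> multilinear_form f -> alternating_form f -> form_k0 I f ->
  multilinear_form g -> alternating_form g -> form_k0 I g ->
  f e != 0 -> forall v, g v = g e / f e * f v.
Proof.
move=> Nm fM fA fI gM gA gI fe v; apply/eqP; rewrite -subr_eq0; apply/eqP.
set c := g e / f e; pose h v := g v - c * f v; rewrite -/(h v).
have hM : multilinear_form h by move=> v' l a u u'; rewrite /h fM gM; ring.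
have hA : alternating_form h.
  by move=> v' l l' ll' vl; rewrite /h (fA _ _ _ ll' vl) (gA _ _ _ ll' vl) mulr0 subr0.
have hI : form_k0 I h.
  move=> v' l; set r := replace _ _ _; transitivity
    ((g v' + ('i)%C * g r) - c * (f v' + ('i)%C * f r)); first by rewrite /h; ring.
  by rewrite gI fI mulr0 subr0.
have he : h e = 0 by rewrite /h /c divfK // subrr.
have heq (q : 'I_m -> 'I_m) : h (e \o q) = 0.
  have [/injectiveP q_inj|/injectivePn[l [l' ll' ql]]] := boolP (injectiveb q).
    have -> : e \o q = e \o perm q_inj by apply/funext => l; rewrite /= permE.
    exact: multilinear_alternating_perm0.
  by apply: (hA _ _ _ ll'); rewrite /= ql.
apply: (multilinear_spanning0 hM (form_k0_basis Nm fM fA fI fe)) => p.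
(* [q] records which e_i is chosen in a slot, and [d] lists the slots where it is I e_i rather than
   e_i. *)
pose q l := match fintype.split (p l) with inl i => i | inr i => i end.
pose d := [seq l <- enum 'I_m | if fintype.split (p l) is inr _ then true else false].
have hs (s : seq 'I_m) :
    h (fun l => if l \in s then I *m e (q l) else e (q l)) = 0.
  elim: s => [|x s IH]; first exact: heq.
  have [xs|xs] := boolP (x \in s).
    rewrite -[RHS]IH; congr h; apply/funext => l; rewrite in_cons.
    by case: eqVneq => // ->; rewrite xs.
  rewrite (_ : (fun l => _) = replace (fun l => if l \in s then I *m e (q l)
    else e (q l)) x (I *m e (q x))); last first.
    apply/funext => l; rewrite in_cons /replace.
    by case: eqVneq => // ->.
  rewrite form_k0E // (_ : replace _ _ _ = fun l => if l \in s then I *m e (q l)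
    else e (q l)) ?IH ?mulr0 //.
  apply/funext => l; rewrite /replace.
  by case: eqVneq => // ->; rewrite (negbTE xs).
rewrite -[RHS](hs d); congr h; apply/funext => l.
rewrite /d mem_filter mem_enum andbT /q /=.
by case: (fintype.split (p l)).
Qed.

(** Since J anticommutes with I, pulling back by J exchanges the types (m,0) and (0,m). Conjugation
    restores (m,0), where any two forms are proportional. *)
Lemma form_k0_anticommuting (m : nat) (J : 'M[R]_N) (f : ('I_m -> V) -> C) e :
  N = (m + m)%N -> J *m I = - (I *m J) ->
  multilinear_form f -> alternating_form f -> form_k0 I f -> f e != 0 ->
  exists c : C, forall v, f (fun l => J *m v l) = c * ((f v)^*)%C.
Proof.
move=> Nm JI fM fA fI fe; pose g v := ((f (fun l => J *m v l))^*)%C.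
have gM : multilinear_form g.
  move=> v l a u u'; rewrite /g !mulmx_replace mulmxDr -scalemxAr fM.
  by rewrite rmorphD rmorphM /= oppr0.
have gA : alternating_form g.
  move=> v l l' ll' vl; rewrite /g (fA _ _ _ ll'); last by rewrite vl.
  by rewrite rmorph0.
have gI : form_k0 I g.
  move=> v l; rewrite /g mulmx_replace mulmxA JI mulNmx -mulmxA.
  rewrite -mulmxN form_k0E // -scaleN1r.
  have := fM (fun j => J *m v j) l (-1) (J *m v l) 0.
  have f0 w : f (replace w l 0) = 0.
    have := fM w l (-1) 0 0; rewrite scaler0 addr0 rmorphN rmorph1 mulN1r.
    by rewrite addNr.
  rewrite addr0 f0 addr0 rmorphN rmorph1 (replace_id (fun j => J *m v j)) => ->.
  by rewrite !rmorphM rmorphN rmorph1; case: (f _) => x y;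
    apply/eqP; rewrite eq_complex /=; apply/andP; split; apply/eqP; ring.
exists (((g e / f e)^*)%C) => v.
have := form_k0_proportional Nm fM fA fI gM gA gI fe v.
by move=> /(congr1 conjc); rewrite /g conjcK rmorphM.
Qed.

Lemma form_k0_mul (m : nat) (f : ('I_m -> V) -> C) v :
  form_k0 I f -> f (fun l => I *m v l) = ('i)%C ^+ m * f v.
Proof.
move=> fI; have fs (s : seq 'I_m) : uniq s ->
    f (fun l => if l \in s then I *m v l else v l) = ('i)%C ^+ size s * f v.
  elim: s => [_|x s IH /andP[xs us]]; first by rewrite expr0 mul1r.
  rewrite /= exprS -mulrA -IH // (_ : (fun l => _) =
    replace (fun l => if l \in s then I *m v l else v l) x (I *m v x)).
    rewrite form_k0E //; congr (_ * f _); apply/funext => l; rewrite /replace.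
    by case: eqVneq => // ->; rewrite (negbTE xs).
  apply/funext => l; rewrite in_cons /replace.
  by case: eqVneq => // ->.
rewrite -{2}(size_enum_ord m) -fs ?enum_uniq //; congr f.
by apply/funext => l; rewrite mem_enum.
Qed.

End ComplexStructure.
End ComplexForms.

(** * Quaternions carrying one complex structure to another *)

Section QuaternionAlgebra.
Context {R : realType} {N : nat}.
Implicit Types I J : 'M[R]_N.

Lemma quat_basis I J : [/\ quat I J 1 0 0 0 = 1%:M, quat I J 0 1 0 0 = I,
  quat I J 0 0 1 0 = J & quat I J 0 0 0 1 = I *m J].
Proof.
have M0 : 0%:M = 0 :> 'M[R]_N by apply/matrixP => i j; rewrite !mxE mul0rn.
by rewrite /quat !scale0r !scale1r !addr0 M0 !add0r.
Qed.

(** With b = b1 I + b2 J + b3 IJ and b^2 = -1, the quaternion T = 1 - I b satisfies T b = b + I = I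
    T. Its coefficients are (1 + b1, 0, b3, -b2) and its norm is 2 (1 + b1), which vanishes only for
    b = -I; there T = J serves. The coefficients are chosen before I and J, so that the same ones
    work at all points. *)
Lemma quat_rotation (b1 b2 b3 : R) : b1 ^+ 2 + b2 ^+ 2 + b3 ^+ 2 = 1 ->
  exists q0 q1 q2 q3 : R, q0 ^+ 2 + q1 ^+ 2 + q2 ^+ 2 + q3 ^+ 2 != 0 /\
    forall I J, I *m I = - 1%:M -> J *m J = - 1%:M -> J *m I = - (I *m J) ->
      quat I J q0 q1 q2 q3 *m quat I J 0 b1 b2 b3 = I *m quat I J q0 q1 q2 q3.
Proof.
move=> b_unit; have IE I J : I = quat I J 0 1 0 0 by have [_ ->] := quat_basis I J.
have [b1E|b1_neqN1] := eqVneq b1 (-1).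
  have [b2E b3E] : b2 = 0 /\ b3 = 0.
    have : b2 ^+ 2 + b3 ^+ 2 == 0 by apply/eqP; rewrite b1E in b_unit; lra.
    by rewrite paddr_eq0 ?sqr_ge0 // !sqrf_eq0 => /andP[/eqP -> /eqP ->].
  exists 0, 0, 1, 0; split; first by rewrite !expr0n expr1n /= addr0 !add0r oner_neq0.
  move=> I J II JJ JI; rewrite [X in _ = X *m _](IE I J) !quat_mul // b1E b2E b3E.
  by congr quat; ring.
exists (1 + b1), 0, b3, (- b2); split.
  rewrite (_ : _ + _ = 2 * (b1 + 1)); last by lra.
  by rewrite mulf_neq0 ?pnatr_eq0 // addr_eq0.
move=> I J II JJ JI; rewrite [X in _ = X *m _](IE I J) !quat_mul //.
by congr quat; lra.
Qed.

End QuaternionAlgebra.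

(** * Closedness and smoothness of quaternionic pullbacks in a chart *)

Section LocalClosedness.
Context {R : realType} {N m : nat}.
Local Notation V := 'cV[R]_N.
Local Notation C := (R[i])%C.

Definition cext (s : V -> ('I_m -> V) -> C) (x : V) (v : 'I_m.+1 -> V) : C :=
  \sum_(l < m.+1) (-1) ^+ l * cderive (fun y => s y (v \o lift l)) x (v l).

Lemma cext_eq0 s x v :
  cext s x v = 0 <->
  ext_derivativeR (fun y u => complex.Re (s y u)) x v = 0 /\
  ext_derivativeR (fun y u => complex.Im (s y u)) x v = 0.
Proof.
have E : cext s x v =
    (ext_derivativeR (fun y u => complex.Re (s y u)) x v +i*
     ext_derivativeR (fun y u => complex.Im (s y u)) x v)%C.
  rewrite /cext /ext_derivativeR.
  elim/big_rec3 : _ => [|l z y u _ ->] //=.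
  rewrite /cderive -[in LHS](signr_odd _ l) -![in RHS](signr_odd _ l).
  by case: (odd l); rewrite ?expr1 ?expr0; apply/eqP; rewrite eq_complex /=;
    apply/andP; split; apply/eqP; ring.
by rewrite E; split => [[-> ->]|[-> ->]].
Qed.

Lemma ext_derivativeR_comb (F G H : V -> ('I_m -> V) -> R) x v (p r : R) :
  (forall u, differentiable (F^~ u) x) -> (forall u, differentiable (G^~ u) x) ->
  (\forall y \near x, forall u, H y u = p * F y u + r * G y u) ->
  ext_derivativeR F x v = 0 -> ext_derivativeR G x v = 0 ->
  ext_derivativeR H x v = 0.
Proof.
move=> dF dG HE F0 G0.
rewrite -[RHS](addr0 0) -{1}(mulr0 p) -{2}(mulr0 r) -{1}F0 -G0.
rewrite !mulr_sumr -big_split; apply: eq_bigr => l _ /=.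
have {}HE : \forall y \near x, H y (v \o lift l) =
    (p *: F^~ (v \o lift l) + r *: G^~ (v \o lift l)) y.
  by near=> y; rewrite (near HE y).
rewrite (near_eq_derive _ HE) deriveD; last 2 first.
- by apply: diff_derivable; exact: differentiableZ.
- by apply: diff_derivable; exact: differentiableZ.
rewrite !deriveZ; [|exact: diff_derivable..].
by rewrite mulrDr; congr (_ + _); rewrite mulrCA.
Unshelve. all: by end_near. Qed.

Lemma closed_quat (I J : V -> 'M[R]_N) (s : V -> ('I_m -> V) -> C) (x : V) (c : C) :
  differentiable I x -> differentiable J x ->
  (\forall y \near x, I y *m I y = - 1%:M) ->
  (\forall y \near x, J y *m J y = - 1%:M) ->
  (\forall y \near x, J y *m I y = - (I y *m J y)) ->
  (forall u v, 'D_(I x *m u) I x *m v - 'D_(I x *m v) I x *m u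
          - I x *m ('D_u I x *m v - 'D_v I x *m u) = 0) ->
  (forall u v, 'D_(J x *m u) J x *m v - 'D_(J x *m v) J x *m u
          - J x *m ('D_u J x *m v - 'D_v J x *m u) = 0) ->
  (\forall y \near x, multilinear_form (s y) /\ alternating_form (s y)) ->
  (forall u, differentiable (fun y => complex.Re (s y u)) x) ->
  (forall u, differentiable (fun y => complex.Im (s y u)) x) ->
  (\forall y \near x, form_k0 (I y) (s y)) ->
  (\forall y \near x, forall v, s y (fun l => J y *m v l) = c * ((s y v)^*)%C) ->
  (forall v, cext s x v = 0) ->
  forall q0 q1 q2 q3, q0 ^+ 2 + q1 ^+ 2 + q2 ^+ 2 + q3 ^+ 2 != 0 -> forall v,
  cext (fun y u => s y (fun l => quat (I y) (J y) q0 q1 q2 q3 *m u l)) x v = 0.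
Proof.
move=> dI dJ II JJ JI NI NJ sMA dRe dIm sI sJ s0 q0 q1 q2 q3 q_neq0 v.
have Re0 v' := ((cext_eq0 s x v').1 (s0 v')).1.
have Im0 v' := ((cext_eq0 s x v').1 (s0 v')).2.
(* [h] will be the real or the imaginary part. Multiplication by a complex constant mixes the two,
   so each base case for one of them uses the closedness of both. *)
have key (h : C -> R) (hRe : exists p r, forall z, h z = p * complex.Re z + r * complex.Im z) :
    (forall f : ('I_m -> V) -> C, multilinear_form f -> rmultilinear (h \o f)) ->
    (forall f : ('I_m -> V) -> C, alternating_form f -> ralternating (h \o f)) ->
    ext_derivativeR (fun y u => h (s y (fun l => quat (I y) (J y) q0 q1 q2 q3 *m u l))) x v = 0.
  move=> hM hA; have [p [r hE]] := hRe.
  have comb (H : V -> ('I_m -> V) -> C) (z z' : C) :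
      (\forall y \near x, forall u, H y u = z * s y u + z' * ((s y u)^*)%C) ->
      forall v', ext_derivativeR (fun y u => h (H y u)) x v' = 0.
    move=> HE v'.
    (* [a] and [b] are the coefficients of Re s and Im s in [h] applied to z s + z' conj(s), the
       shape shared by the four base pullbacks. *)
    pose a := p * (complex.Re z + complex.Re z') + r * (complex.Im z + complex.Im z').
    pose b := p * (complex.Im z' - complex.Im z) + r * (complex.Re z - complex.Re z').
    apply: (@ext_derivativeR_comb _ _ _ x v' a b dRe dIm _ (Re0 v') (Im0 v')).
    near=> y => u; rewrite (near HE y) // hE /a /b.
    by case: (s y u) => e f; case: (z) => ? ?; case: (z') => ? ? /=; ring.
  have hd u : differentiable (fun y => h (s y u)) x.
    rewrite (_ : (fun y => _) = p *: (fun y => complex.Re (s y u))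
       + r *: (fun y => complex.Im (s y u))); last by apply/funext => y; rewrite hE.
    by apply: differentiableD; exact: differentiableZ.
  have sM : \forall y \near x, rmultilinear (h \o s y).
    by near=> y; apply/hM; have [] := near sMA y.
  have sA : ralternating (h \o s x) by apply/hA; have [] := nbhs_singleton sMA.
  have := @ext_derivative_quat _ _ I J x dI dJ II JJ JI NI NJ m
    (fun y u => h (s y u)) v sM sA hd.
  apply => //.
  - move=> v'; apply: (comb (fun y u => s y (fun l => quat (I y) (J y) 1 0 0 0 *m u l)) 1 0).
    near=> y => u; have [-> _ _ _] := quat_basis (I y) (J y).
    rewrite mul1r mul0r addr0; congr (s y _).
    by apply/funext => l; rewrite mul1mx.
  - move=> v'; apply: (comb (fun y u => s y (fun l => quat (I y) (J y) 0 1 0 0 *m u l)) ('i%C ^+ m) 0).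
    near=> y => u; have [_ -> _ _] := quat_basis (I y) (J y).
    by rewrite mul0r addr0 form_k0_mul //; near: y.
  - move=> v'; apply: (comb (fun y u => s y (fun l => quat (I y) (J y) 0 0 1 0 *m u l)) 0 c).
    near=> y => u; have [_ _ -> _] := quat_basis (I y) (J y).
    by rewrite mul0r add0r (near sJ y).
  (* The form is evaluated on I (J v): type (m,0) takes out i^m, and what is left is the pullback by
     J. *)
  - move=> v'; apply: (comb (fun y u => s y (fun l => quat (I y) (J y) 0 0 0 1 *m u l)) 0 ('i%C ^+ m * c)).
    near=> y => u; have [_ _ _ ->] := quat_basis (I y) (J y).
    rewrite mul0r add0r -mulrA -(near sJ y) // -(form_k0_mul (I := I y)); last by near: y.
    by congr (s y _); apply/funext => l; rewrite mulmxA.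
apply/cext_eq0; split.
  apply: key; last by move=> f; exact: Re_alternating.
    by exists 1, 0 => z; rewrite mul1r mul0r addr0.
  by move=> f; exact: Re_multilinear.
apply: key; last by move=> f; exact: Im_alternating.
  by exists 0, 1 => z; rewrite mul1r mul0r add0r.
by move=> f; exact: Im_multilinear.
Unshelve. all: by end_near. Qed.

Lemma smooth_multilinear (U : set V) (F : V -> ('I_m -> V) -> R) (X : V -> 'I_m -> V) :
  open U -> (forall y, U y -> rmultilinear (F y)) ->
  (forall u, smooth_on U (F^~ u)) -> (forall l i, smooth_on U (fun y => X y l i 0)) ->
  smooth_on U (fun y => F y (X y)).
Proof.
move=> Uo FM FU XU k.
pose e (j : 'I_N) : V := delta_mx j 0.
have eE (u : V) : u = \sum_j u j 0 *: e j.
  by rewrite [LHS]matrix_sum_delta; apply: eq_bigr => j _; rewrite big_ord1.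
apply: (@Ck_ext _ _ _ k U (fun y => \sum_(p : {ffun 'I_m -> 'I_N})
    (\prod_l X y l (p l) 0) * F y (e \o p))) => //.
  move=> y; rewrite inE => /FM FyM.
  by rewrite (rmultilinear_expand (a := fun l j => X y l j 0) (b := e) FyM).
apply: Ck_sum => // p.
apply: (@CkM _ _ k U (fun y => \prod_l X y l (p l) 0) (F^~ (e \o p))) => //.
  by apply: Ck_prod => // l; exact: XU.
exact: FU.
Qed.

Lemma smooth_quat (U : set V) (I J : V -> 'M[R]_N) q0 q1 q2 q3 u i : open U ->
  smooth_on U I -> smooth_on U J ->
  smooth_on U (fun y => (quat (I y) (J y) q0 q1 q2 q3 *m (u : V)) i 0).
Proof.
move=> Uo IU JU k.
have IE j l : Ck k U (fun y => I y j l) by apply: Ck_entry => //; exact: IU.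
have JE j l : Ck k U (fun y => J y j l) by apply: Ck_entry => //; exact: JU.
have cst a : Ck k U (fun=> a : R) by exact: Ck_cst.
rewrite (_ : (fun y => _) = fun y => \sum_j (q0%:M i j + q1 * I y i j
    + q2 * J y i j + q3 * \sum_l I y i l * J y l j) * u j 0); last first.
  by apply/funext => y; rewrite mxE; apply: eq_bigr => j _; rewrite !mxE.
apply: Ck_sum => // j; apply: CkM (cst _) => //.
apply: CkD => //; last first.
  apply: CkM => //; apply: Ck_sum => // l; exact: CkM.
by apply: CkD => //; [apply: CkD => //|]; exact: CkM.
Qed.

End LocalClosedness.

(** * Charts of the quotient *)

Local Notation coord := Defs.coord.

Section QuotientCharts.
Context {R : realType} {N : nat} {G : groupTopologicalType}.
Variables (A : atlas R N G) (Gam : groupClosed G).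
Local Notation Q := (quotient_atlas Gam A).

Lemma coset_pi_eq g h : coset_pi Gam g = coset_pi Gam h -> (h / g)%g \in Gam.
Proof. by move=> /eqmodP. Qed.

Lemma coset_pi_mul k g : k \in Gam -> coset_pi Gam (k * g)%g = coset_pi Gam g.
Proof.
move=> kG; apply/eqmodP; rewrite /= /coset_rel invMg mulgA mulgV mul1g.
by rewrite gpredV.
Qed.

Lemma qsectionK (c : chart Q) g : qset c g -> qsection c (coset_pi Gam g) = g.
Proof.
move=> cg; apply: xget_unique => // h [ch hg].
by apply: (@qset_inj _ _ _ _ _ c) hg; rewrite inE.
Qed.

Lemma quotient_coordE (c : chart Q) g :
  qset c g -> coord c (coset_pi Gam g) = coord (qchart c) g.
Proof. by move=> cg /=; rewrite qsectionK. Qed.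

Lemma quotient_imgP (c : chart Q) x :
  img c x -> exists2 g, qset c g & x = coord (qchart c) g.
Proof. by move=> [_ [g cg <-] <-]; exists g => //; rewrite quotient_coordE. Qed.

Lemma quotient_img_sub (c : chart Q) x : img c x -> img (qchart c) x.
Proof. by move=> /quotient_imgP[g cg ->]; exists g => //; exact: qset_sub. Qed.

Hypothesis A_manifold : smooth_manifold A.

Let open_img i : open (img (A := A) i).
Proof. by have [_ _ /(_ i)[]] := A_manifold. Qed.
Let parK (i : chart A) g : dom i g -> par i (coord i g) = g :> G.
Proof. by have [_ _ /(_ i)[_ _ +] _ _] := A_manifold; apply. Qed.

Lemma near_par (i : chart A) g (B : set G) : dom i g -> open B -> B g ->
  \forall y \near coord i g, img i y /\ B (par i y).
Proof.
move=> ig Bo Bg; have img_g : img i (coord i g) by exists g.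
have [_ _ _ /(_ i)[_ par_cont] _] := A_manifold.
rewrite continuous_open_subspace // in par_cont.
have /par_cont par_g : coord i g \in img i by rewrite inE.
apply: filterI; first exact: open_nbhs_nbhs.
by apply: par_g; rewrite parK //; exact: open_nbhs_nbhs.
Qed.

Lemma open_quotient_img (c : chart Q) : open (img c).
Proof.
rewrite openE => x /quotient_imgP[g cg ->].
have := near_par (qset_sub cg) (qset_open c) cg.
apply: filterS => y [[q iq <-]]; rewrite parK // => cq.
by exists (coset_pi Gam q); [exists q|rewrite quotient_coordE].
Qed.

(** The chart [c] is [qchart c] pushed down, so in this pair of charts the projection is the
    identity near [g]. *)
Lemma tangent_map_pi (c : chart Q) g v : qset c g ->
  tangent_map (coset_pi Gam) (qchart c) c g v = v.
Proof.
move=> cg; rewrite /tangent_map -[RHS](derive_id (coord (qchart c) g) v).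
apply: near_eq_derive.
have := near_par (qset_sub cg) (qset_open c) cg.
apply: filterS => y [[q iq <-]]; rewrite parK // => cq.
by rewrite /local_rep /= parK // qsectionK.
Qed.

(** A change of quotient charts is, upstairs, left translation by the lattice element [h / g].
    Continuity of that translation keeps points near [g] inside [qset c'], where the section returns
    exactly the translated point. *)
Lemma quotient_transition (c c' : chart Q) g h : qset c g -> qset c' h ->
  coset_pi Gam g = coset_pi Gam h ->
  continuous (fun u : G => (h / g * u)%g) ->
  forall v, tangent_map id c c' (coset_pi Gam g) v =
    tangent_map (fun u : G => h / g * u)%g (qchart c) (qchart c') g v.
Proof.
move=> cg ch gh kc v; rewrite /tangent_map quotient_coordE //.
apply: near_eq_derive; have kG := coset_pi_eq gh.
have open_k : open [set u : G | qset c' (h / g * u)%g].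
  by apply: open_comp (qset_open c') => u _; exact: kc.
have kg : [set u : G | qset c' (h / g * u)%g] g by rewrite /= mulgVK.
have := near_par (qset_sub cg) open_k kg.
apply: filterS => y [_ /= cy].
by rewrite /local_rep /= -(coset_pi_mul (par (qchart c) y) kG) qsectionK.
Qed.

End QuotientCharts.

Lemma nijenhuisE {R : realType} {N : nat} {M : topologicalType} {A : atlas R N M}
    (J : endo_field A) i u v x : differentiable (J i) x ->
  nijenhuis J i u v x =
    'D_(J i x *m u) (J i) x *m v - 'D_(J i x *m v) (J i) x *m u
    - J i x *m ('D_u (J i) x *m v - 'D_v (J i) x *m u).
Proof.
move=> dJ; have DJ z t : 'D_z (fun y => J i y *m t) x = 'D_z (J i) x *m t.
  have dJz := derivableP (diff_derivable dJ) : is_derive x z _ _.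
  have := is_derive_mulmx dJz (is_derive_cst t x z).
  by move=> /@derive_val; rewrite mulmx0 addr0.
rewrite /nijenhuis /vf_bracket !DJ !derive_cst.
move: ('D_(J i x *m u) (J i) x) ('D_(J i x *m v) (J i) x) ('D_u (J i) x)
  ('D_v (J i) x) => P1 P2 P3 P4.
by rewrite sub0r !subr0 [- _ + _]addrC.
Qed.

(** * The pulled-back section on the quotient *)

Section HypercomplexPair.
Context {R : realType} {N : nat} {G : groupTopologicalType}.
Variables (A : atlas R N G) (Gam : groupClosed G) (I J : endo_field A).
Local Notation Q := (quotient_atlas Gam A).
Local Notation m := N./2.
Hypotheses (lieA : lie_group A) (I_cx : complex_structure I)
  (J_cx : complex_structure J)
  (JI : forall i x, img i x -> J i x *m I i x = - (I i x *m J i x))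
  (I_inv : left_invariant_endo I) (J_inv : left_invariant_endo J).
Variable s : cform Q m.
Hypotheses (s_inv : invariant_form s)
  (s_triv : trivializing_section (quotient_endo Gam I) s).

Let A_manifold : smooth_manifold A. Proof. by case: lieA. Qed.
Let II i x : img i x -> I i x *m I i x = - 1%:M.
Proof. by case: I_cx => _ + _; exact. Qed.
Let JJ i x : img i x -> J i x *m J i x = - 1%:M.
Proof. by case: J_cx => _ + _; exact. Qed.

Let sK0 (c : chart Q) x : img c x -> form_k0 (I (qchart c) x) (s c x).
Proof. by move=> cx v l; have [_ /(_ c x v l cx)] := s_triv. Qed.
Let sMA (c : chart Q) x : img c x ->
  multilinear_form (s c x) /\ alternating_form (s c x).
Proof. by have [[/(_ c x)]] := s_triv. Qed.

(* Left translation carries the relation at [x0] to every other point with the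
   same constant. *)
Lemma anticommuting_constant (c : chart Q) x0 : img c x0 ->
  exists z : R[i]%C, forall x v, img c x ->
    s c x (fun l => J (qchart c) x *m v l) = z * ((s c x v)^*)%C.
Proof.
move=> cx0; have [e se] : exists e, s c x0 e != 0.
  by have [_ _ /(_ c x0 cx0)] := s_triv.
have ix0 := quotient_img_sub cx0.
have [sM sA] := sMA cx0.
have [z zE] := form_k0_anticommuting (even_dim (II ix0)) (JI ix0) sM sA
  (sK0 cx0) se.
exists z => x v cx; have [w [_ w_inv s_w]] := s_inv.
have [g0 cg0 x0E] := quotient_imgP cx0.
have [g cg xE] := quotient_imgP cx.
(* Left translations by arbitrary elements need not descend to the quotient, so [s] is compared with
   its lift [w], which has the same local expression. *)
have sE h u : qset c h -> s c (coord (qchart c) h) u = w (qchart c) (coord (qchart c) h) u.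
  move=> ch; have dh := qset_sub ch.
  rewrite (s_w _ c h u dh); last by exists h.
  rewrite quotient_coordE //; congr (s _ _ _).
  by apply/funext => l; rewrite tangent_map_pi.
(* [k] moves [g] to [g0] and need not lie in the lattice. Its differential [tau] preserves the form
   and commutes with J, which transports the relation. *)
pose k := (g0 / g)%g; pose tau := tangent_map (fun h => k * h)%g (qchart c) (qchart c) g.
have kg : (k * g)%g = g0 by rewrite mulgVK.
have kdom : dom (qchart c) (k * g)%g by rewrite kg; exact: qset_sub.
have s_tau u : s c x u = s c x0 (fun l => tau (u l)).
  rewrite xE x0E !sE //.
  by rewrite (w_inv k _ _ _ _ (qset_sub cg) kdom) kg.
rewrite !s_tau -zE; congr (s c x0 _); apply/funext => l.
have [_ /(_ _ _ _ (v l) (qset_sub cg) kdom)] := J_inv k.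
by rewrite kg -xE -x0E.
Qed.

Variables q0 q1 q2 q3 : R.
Hypothesis q_neq0 : q0 ^+ 2 + q1 ^+ 2 + q2 ^+ 2 + q3 ^+ 2 != 0.

Definition quat_field : endo_field Q :=
  fun c x => quat (I (qchart c) x) (J (qchart c) x) q0 q1 q2 q3.

Definition quat_pullback : cform Q m :=
  fun c x v => s c x (fun l => quat_field c x *m v l).

Let smoothI (c : chart Q) : smooth_on (img c) (I (qchart c)).
Proof.
move=> k; have [[_ /(_ (qchart c) k) Ik] _ _] := I_cx.
by apply: (Ck_sub _ Ik) => x; exact: quotient_img_sub.
Qed.
Let smoothJ (c : chart Q) : smooth_on (img c) (J (qchart c)).
Proof.
move=> k; have [[_ /(_ (qchart c) k) Jk] _ _] := J_cx.
by apply: (Ck_sub _ Jk) => x; exact: quotient_img_sub.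
Qed.

(** Changes of quotient charts are left translations, whose differentials commute with I and J and
    hence with every quaternion with constant coefficients. *)
Lemma quat_field_intertwines : intertwines id quat_field quat_field.
Proof.
move=> c c' p v [g cg <-] [h ch /esym gh].
pose k := (h / g)%g; have [[k_cont k_smooth] kI] := I_inv k.
have [_ kJ] := J_inv k; have kg : (k * g)%g = h by rewrite mulgVK.
have kdom : dom (qchart c') (k * g)%g by rewrite kg; exact: qset_sub.
rewrite !(quotient_transition A_manifold cg ch gh k_cont) {2}gh !quotient_coordE //.
set tau := tangent_map _ _ _ _.
(* A directional derivative is additive in the direction once the map is differentiable; smoothness
   of the translation provides this. *)
have tauE u : tau u = 'd (local_rep (A := A) (A' := A) (fun h => k * h)%g
    (qchart c) (qchart c')) (coord (qchart c) g) u.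
  rewrite /tau /tangent_map deriveE //.
  have [+ _] := k_smooth (qchart c) (qchart c') 1%N; apply.
  by exists g => //; split => //; exact: qset_sub.
have tauD u u' : tau (u + u') = tau u + tau u' by rewrite !tauE linearD.
have tauZ a u : tau (a *: u) = a *: tau u by rewrite !tauE linearZ.
have tauI u := kI _ _ _ u (qset_sub cg) kdom.
have tauJ u := kJ _ _ _ u (qset_sub cg) kdom.
rewrite -/tau kg in tauI tauJ.
rewrite /quat_field /quat !mulmxDl !mul_scalar_mx -!scalemxAl !tauD !tauZ.
by rewrite -!mulmxA !(tauI, tauJ).
Qed.

Lemma quat_pullback_differential_form : differential_form quat_pullback.
Proof.
have [[s_lin s_pull s_smooth] _ _ _] := s_triv.
split=> [c x cx|c c' p v cp cp'|c v].
- have [sM sA] := sMA cx; split.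
    move=> v l a u u'; rewrite /quat_pullback !mulmx_replace mulmxDr -scalemxAr.
    exact: sM.
  by move=> v l l' ll' vl; apply: (sA _ _ _ ll'); rewrite vl.
- rewrite /quat_pullback (s_pull _ _ _ _ cp cp'); congr (s _ _ _).
  by apply/funext => l; exact: quat_field_intertwines.
- have Uo : open (img c) by exact: open_quotient_img.
  have qS l i : smooth_on (img c) (fun y => (quat_field c y *m v l) i 0).
    exact: smooth_quat.
  split.
    apply: (@smooth_multilinear _ _ _ _ (fun y u => complex.Re (s c y u))
      (fun y l => quat_field c y *m v l)) => //.
      by move=> y /sMA[/Re_multilinear].
    by move=> u; have [] := s_smooth c u.
  apply: (@smooth_multilinear _ _ _ _ (fun y u => complex.Im (s c y u))
    (fun y l => quat_field c y *m v l)) => //.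
    by move=> y /sMA[/Im_multilinear].
  by move=> u; have [] := s_smooth c u.
Qed.

Lemma quat_pullback_nowhere_vanishing : nowhere_vanishing quat_pullback.
Proof.
move=> c x cx; have ix := quotient_img_sub cx.
have [_ _ /(_ c x cx)[v sv] _] := s_triv.
have := q_neq0; set n := (X in X != 0) => n_neq0.
exists (fun l => n^-1 *: (quat (I (qchart c) x) (J (qchart c) x) q0 (- q1) (- q2) (- q3) *m v l)).
rewrite /quat_pullback (_ : (fun l => _) = v) //; apply/funext => l.
have := quat_conj_mul (II ix) (JJ ix) (JI ix) q0 (- q1) (- q2) (- q3).
rewrite !opprK !sqrrN -/n => e.
by rewrite -scalemxAr mulmxA e mul_scalar_mx scalerA mulVf // scale1r.
Qed.

Lemma quat_pullback_closed : closed_form quat_pullback.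
Proof.
move=> c x v cx; have ix := quotient_img_sub cx.
(* The constant may change with the chart; closedness at [x] only needs it to be constant near
   [x]. *)
have [z zE] := anticommuting_constant cx.
have near_img : \forall y \near x, img c y.
  by apply: open_nbhs_nbhs; split => //; exact: open_quotient_img.
have dI : differentiable (I (qchart c)) x by exact: (smoothI c 1%N).1.
have dJ : differentiable (J (qchart c)) x by exact: (smoothJ c 1%N).1.
have [[_ _ s_smooth] _ _ s_closed] := s_triv.
apply: (@closed_quat _ _ _ _ _ (s c) x z dI dJ _ _ _ _ _ _ _ _ _ _ _
  _ _ _ _ q_neq0 v).
- by apply: filterS near_img => y /quotient_img_sub; exact: II.
- by apply: filterS near_img => y /quotient_img_sub; exact: JJ.
- by apply: filterS near_img => y /quotient_img_sub; exact: JI.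
- by move=> u u'; rewrite -nijenhuisE //; case: I_cx => _ _; apply.
- by move=> u u'; rewrite -nijenhuisE //; case: J_cx => _ _; apply.
- by apply: filterS near_img => y; exact: sMA.
- by move=> u; have [/(_ 1%N)[+ _] _] := s_smooth c u; apply.
- by move=> u; have [_ /(_ 1%N)[+ _]] := s_smooth c u; apply.
- by apply: filterS near_img => y; exact: sK0.
- by apply: filterS near_img => y cy u; exact: zE.
- by move=> u; exact: s_closed.
Qed.

(** The relation T J_a = I T moves J_a in a slot of the pullback to I in the same slot of [s], so
    the type for I becomes the type for J_a. *)
Lemma quat_pullback_trivializing (Ja : endo_field Q) :
  (forall c x, img c x -> quat_field c x *m Ja c x = I (qchart c) x *m quat_field c x) ->
  trivializing_section Ja quat_pullback.
Proof.
move=> qJ; split.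
- exact: quat_pullback_differential_form.
- move=> c x v l cx; rewrite /quat_pullback mulmx_replace mulmxA qJ // -mulmxA.
  exact: (sK0 cx).
- exact: quat_pullback_nowhere_vanishing.
- exact: quat_pullback_closed.
Qed.

End HypercomplexPair.

(** Indices are taken modulo 3: a hypercomplex triple stays one after a cyclic shift, so any given
    [al] can play the role of the first structure. *)
Lemma hypercomplex_cyclic (R : realType) (N : nat) (J : 'I_3 -> 'M[R]_N) :
  (forall al, J al *m J al = - 1%:M) -> J 0 *m J 1 = J 2 -> J 1 *m J 0 = - J 2 ->
  forall al, J al *m J (al + 1) = J (al + 2) /\
    J (al + 1) *m J al = - (J al *m J (al + 1)).
Proof.
move=> JJ J01 J10.
have J12 : J 1 *m J 2 = J 0.
  by rewrite -[J 2]opprK -J10 mulmxN mulmxA JJ mulNmx mul1mx opprK.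
have J21 : J 2 *m J 1 = - J 0 by rewrite -J01 -mulmxA JJ mulmxN mulmx1.
have J20 : J 2 *m J 0 = J 1.
  by rewrite -[J 2]opprK -J10 mulNmx -mulmxA JJ mulmxN mulmx1 opprK.
have J02 : J 0 *m J 2 = - J 1 by rewrite -J01 mulmxA JJ mulNmx mul1mx.
have cases (P : 'I_3 -> Prop) : P 0 -> P 1 -> P 2 -> forall al, P al.
  by move=> P0 P1 P2 [[|[|[|//]]] i]; [move: P0|move: P1|move: P2];
     congr P; exact: val_inj.
have e : (((0 + 1)%R = 1%R :> 'I_3) * ((0 + 2)%R = 2%R :> 'I_3) *
    ((1 + 1)%R = 2%R :> 'I_3) * ((1 + 2)%R = 0%R :> 'I_3) *
    ((2 + 1)%R = 0%R :> 'I_3) * ((2 + 2)%R = 1%R :> 'I_3))%type.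
  by do !split; exact: val_inj.
by apply: cases; rewrite !e ?J01 ?J10 ?J12 ?J21 ?J20 ?J02.
Qed.

Lemma sum_cyclic3 (V : nmodType) (F : 'I_3 -> V) al :
  \sum_(l < 3) F l = F al + F (al + 1) + F (al + 2).
Proof.
have shift : bijective (fun l : 'I_3 => al + l).
  exists (fun l => l - al) => l; first by rewrite addrAC subrr add0r.
  by rewrite addrC subrK.
rewrite (reindex _ (onW_bij _ shift)) !big_ord_recl big_ord0 /= [X in F X](addr0 al) addrA.
by rewrite addr0; congr (_ + F (_ + _) + F (_ + _)); exact: val_inj.
Qed.

Unset Implicit Arguments.

Theorem corollary6p2 (R : realType) (N : nat) (G : groupTopologicalType)
    (A : atlas R N G) (J : 'I_3 -> endo_field A) (Gam : groupClosed G) :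
  lie_group A ->
  simply_connected R G ->
  hypercomplex_structure J ->
  (forall al : 'I_3, left_invariant_endo (J al)) ->
  uniform_lattice Gam ->
  (exists (al : 'I_3) (s : cform (quotient_atlas Gam A) N./2),
      invariant_form s /\
      trivializing_section (quotient_endo Gam (J al)) s) ->
  forall a : 'rV[R]_3, \sum_(al < 3) a 0 al ^+ 2 = 1 ->
    trivial_canonical_bundle
      (endo_comb a (fun al => quotient_endo Gam (J al))).
Proof.
move=> lieA _ [J_cx J_hyper] J_inv _ [al [s [s_inv s_triv]]] a a1.
(* With I = J_al, J = J_(al+1) and IJ = J_(al+2), the structure J_a is the imaginary quaternion
   whose coordinates are those of [a] read cyclically from [al]. *)
rewrite (sum_cyclic3 _ al) in a1.
have [q0 [q1 [q2 [q3 [q_neq0 qE]]]]] := @quat_rotation R N _ _ _ a1.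
have cyc i x : img i x -> J al i x *m J (al + 1) i x = J (al + 2) i x /\
    J (al + 1) i x *m J al i x = - (J al i x *m J (al + 1) i x).
  move=> ix; have [J01 J10] := J_hyper i x ix.
  apply: (hypercomplex_cyclic (J := fun l => J l i x)) => // l.
  by have [_ + _] := J_cx l; apply.
have JI i x ix := (cyc i x ix).2.
exists (quat_pullback (J al) (J (al + 1)) s q0 q1 q2 q3).
apply: (quat_pullback_trivializing lieA (J_cx al) (J_cx (al + 1)) JI (J_inv al)
  (J_inv (al + 1)) s_inv s_triv q_neq0) => c x cx.
have ix := quotient_img_sub cx.
rewrite /endo_comb (sum_cyclic3 _ al) /quat_field /quotient_endo.
have [_ II _] := J_cx al; have [_ JJ _] := J_cx (al + 1).
have := qE _ _ (II _ _ ix) (JJ _ _ ix) (JI _ _ ix).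
rewrite {2}/quat (cyc _ _ ix).1 => <-; congr (_ *m _).
have M0 : 0%:M = 0 :> 'M[R]_N by apply/matrixP => i j; rewrite !mxE mul0rn.
by rewrite M0 add0r.
Qed.
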